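(* Given a true strategy $P$ and a stated strategy $Q$ (both with complete lists) on $n$ men and $n$ women, the algorithm described in the context outputs ''Yes'' if and only if $Q$ is a $P$-stable Nash equilibrium, and it runs in $O(n^4)$ time.
   Context: A strategy assigns to each man a complete strict preference list (permutation) of the women and to each woman a complete strict preference list of the men; $Q(a)$ is $a$'s list. For a woman $w$, $\mathcal{Q}_w$ is the set of strategies $(Q(-w),Q'(w))$ obtained from $Q$ by replacing only $w$'s list by a permutation $Q'(w)$. $\mu_{Q}$ is the output of the men-proposing Gale–Shapley algorithm (GS-M) on $Q$ (deterministic: the single man of smallest index proposes next), i.e. the man-optimal $Q$-stable matching. A matching $\mu$ is $P$-stable if there is no pair $(m,w)$ with $w$ preferred to $\mu[m]$ in $P(m)$ and $m$ preferred to $\mu[w]$ in $P(w)$. A strategy $Q'\in\mathcal{Q}_w$ is a $P$-stable manipulation strategy of $w$ if $w$ strictly prefers $\mu_{Q'}[w]$ to $\mu_Q[w]$ in $P(w)$ and $\mu_{Q'}$ is $P$-stable. $Q$ is a $P$-stable Nash equilibrium if no woman has a $P$-stable manipulation strategy. For a tuple $I$ of distinct men, $Q(I;w)$ is $Q(w)$ with the men of $I$ moved to the front in the order of $I$; $Q(x,I;w)$ is $Q(J;w)$ with $J=(x,I)$. A man is active in a list $L$ of $w$ if he proposes to $w$ during GS-M on $(Q(-w),L)$. Subroutine $\mathcal{A}(Q,w)$: let $x_1$ be the first man proposing to $w$ in GS-M on $Q$; set $N=\{x_1\}$, $L=\{Q(x_1;w)\}$, call $\mathbf{Explore}(Q(x_1;w))$,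 where $\mathbf{Explore}$ on a list $Q(x,I;w)$ runs GS-M on $(Q(-w),Q(x,I;w))$, lets $A$ be the men proposing to $w$ after $x$, and for each $y\in A\setminus N$ adds $y$ to $N$, adds $Q(y,x,I;w)$ to $L$, and calls $\mathbf{Explore}(Q(y,x,I;w))$; output $(N,L)$. Main algorithm: for each woman $w$, run $\mathcal{A}(Q,w)$ to get $(N_w,L_w)$; let $N'$ be the set of $m\in N_w$ that $w$ prefers to $\mu_Q[w]$ in $P(w)$; for each $m\in N'$ take the list $Q(m,I;w)\in L_w$ associated with $m$, compute $\mu=\mu_{(Q(-w),Q(m,I;w))}$, and if $\mu$ is $P$-stable return ''No''. If no such case occurs, return ''Yes''. *)

(* Defs.v *)
(* Mathematical Components only. *)
From mathcomp Require Import all_boot.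

Set Implicit Arguments.
Unset Strict Implicit.
Unset Printing Implicit Defensive.

(* Men and women are both indexed by 'I_n; lists are given best choice first. *)
Record strategy (n : nat) := Strategy {
  men : 'I_n -> seq 'I_n;
  women : 'I_n -> seq 'I_n }.

Definition complete_list n (l : seq 'I_n) := perm_eq l (enum 'I_n).

Definition complete n (Q : strategy n) :=
  (forall m, complete_list (men Q m)) /\ (forall w, complete_list (women Q w)).

(* The strategy (Q(-w), l). *)
Definition replace n (Q : strategy n) (w : 'I_n) (l : seq 'I_n) : strategy n :=
  Strategy (men Q) (fun v => if v == w then l else women Q v).

(* A matching sends each woman to her husband.  Being single (None) is ranked
   after every entry of a list; a complete instance never uses this. *)
Definition matching (n : nat) := {ffun 'I_n -> option 'I_n}.

Definition wife n (mu : matching n) (m : 'I_n) : option 'I_n :=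
  [pick w | mu w == Some m].

Definition position n (l : seq 'I_n) (a : option 'I_n) : nat :=
  if a is Some x then index x l else size l.

Definition prefers n (l : seq 'I_n) (a b : option 'I_n) : bool :=
  position l a < position l b.

Definition stable n (P : strategy n) (mu : matching n) : Prop :=
  ~ exists m w : 'I_n,
      prefers (men P m) (Some w) (wife mu m) /\
      prefers (women P w) (Some m) (mu w).

(* The state of GS-M: the women to whom each man has not yet proposed, and the
   current engagements. *)
Record gs_state (n : nat) := GsState {
  untried : {ffun 'I_n -> seq 'I_n};
  engaged : matching n }.

Definition gs_start n (Q : strategy n) : gs_state n :=
  GsState [ffun m => men Q m] [ffun=> None].

(* One proposal, by the single man of smallest index ('enum' is increasing). *)
Definition gs_step n (Q : strategy n) (s : gs_state n) : gs_state n :=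
  if [seq m <- enum 'I_n | (wife (engaged s) m == None)
                           && (untried s m != [::])] is m :: _ then
    if untried s m is w :: r then
      GsState [ffun i => if i == m then r else untried s i]
              [ffun v => if (v == w)
                            && prefers (women Q w) (Some m) (engaged s w)
                         then Some m else engaged s v]
    else s
  else s.

(* Each man proposes at most n times, so GS-M has stopped after n * n steps. *)
Definition mu n (Q : strategy n) : matching n :=
  engaged (iter (n * n) (gs_step Q) (gs_start Q)).

Definition stable_manipulation n (P Q : strategy n) (w : 'I_n) (l : seq 'I_n) :=
  [/\ complete_list l,
      prefers (women P w) (mu (replace Q w l) w) (mu Q w)
    & stable P (mu (replace Q w l))].

Definition stable_nash n (P Q : strategy n) : Prop :=
  ~ exists (w : 'I_n) (l : seq 'I_n), stable_manipulation P Q w l.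

(* Unit-cost computations: a value together with the number of elementary steps
   spent on it.  A step is one array access, one comparison or arithmetic
   operation on indices, one pointer update, or one iteration of a loop.
   Matching on a constructor, building a cell of bounded size and passing
   pointers are free; everything else is built from the operations below, so
   no unbounded amount of work is free.  Arrays are finite functions indexed by
   'I_n and an array is never read after it has been superseded by an update,
   so that updates can be done in place. *)
Definition timed (A : Type) := (A * nat)%type.

Definition result A (c : timed A) : A := c.1.
Definition cost A (c : timed A) : nat := c.2.

Definition ret A (a : A) : timed A := (a, 0).
Definition op A (a : A) : timed A := (a, 1).
Definition bind A B (c : timed A) (f : A -> timed B) : timed B :=
  ((f c.1).1, c.2 + (f c.1).2).

Notation "'let!' x ':=' c 'in' d" := (bind c (fun x => d))
  (at level 200, x name, c at level 200, d at level 200,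
   format "'[v' 'let!'  x  ':='  c  'in' '/' d ']'").

Definition array (n : nat) (T : Type) := {ffun 'I_n -> T}.

Definition get n T (a : array n T) (i : 'I_n) : timed T := op (a i).

Definition put n T (a : array n T) (i : 'I_n) (x : T) : timed (array n T) :=
  op [ffun j => if j == i then x else a j].

Definition build n T (f : 'I_n -> timed T) : timed (array n T) :=
  ([ffun i => (f i).1], \sum_(i < n) ((f i).2 + 1)).

Definition indices (n : nat) : timed (seq 'I_n) := (enum 'I_n, n).

Fixpoint foldT A S (f : S -> A -> timed S) (s : S) (l : seq A) : timed S :=
  let! _ := op tt in
  if l is a :: l' then let! s' := f s a in foldT f s' l' else ret s.

Fixpoint hasT A (p : A -> timed bool) (l : seq A) : timed bool :=
  let! _ := op tt in
  if l is a :: l' then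
    let! b := p a in
    if b then ret true else hasT p l'
  else ret false.

Fixpoint filterT A (p : A -> timed bool) (l : seq A) : timed (seq A) :=
  let! _ := op tt in
  if l is a :: l' then
    let! b := p a in
    let! r := filterT p l' in
    ret (if b then a :: r else r)
  else ret [::].

Fixpoint catT A (l1 l2 : seq A) : timed (seq A) :=
  let! _ := op tt in
  if l1 is a :: l' then let! r := catT l' l2 in ret (a :: r) else ret l2.

Definition memT n (x : 'I_n) (l : seq 'I_n) : timed bool :=
  hasT (fun y => op (x == y)) l.

(* The part of l that follows the first occurrence of x. *)
Fixpoint afterT n (x : 'I_n) (l : seq 'I_n) : timed (seq 'I_n) :=
  let! _ := op tt in
  if l is y :: l' then
    let! b := op (x == y) in
    if b then ret l' else afterT x l'
  else ret [::].

Fixpoint lookupT n T (x : 'I_n) (l : seq ('I_n * T)) : timed (option T) :=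
  let! _ := op tt in
  if l is (y, t) :: l' then
    let! b := op (x == y) in
    if b then ret (Some t) else lookupT x l'
  else ret None.

Fixpoint insertT n (x : 'I_n) (l : seq 'I_n) : timed (seq 'I_n) :=
  let! _ := op tt in
  if l is y :: l' then
    let! b := op (x < y) in
    if b then ret (x :: l) else let! r := insertT x l' in ret (y :: r)
  else ret [:: x].

(* Q must survive, so the women's pointers to their lists are copied. *)
Definition replaceT n (Q : strategy n) (w : 'I_n) (l : seq 'I_n)
    : timed (strategy n) :=
  (replace Q w l, n + 1).

(* The inverse of a preference list, as an array. *)
Definition rank_tableT n (l : seq 'I_n) : timed (array n nat) :=
  let! t0 := build (fun _ : 'I_n => ret n) in
  let! s := foldT (fun (s : array n nat * nat) a =>
                     let! t := put s.1 a s.2 in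
                     let! k := op s.2.+1 in
                     ret (t, k))
                  (t0, 0) l in
  ret s.1.

Definition rank_tablesT n (f : 'I_n -> seq 'I_n) : timed (array n (array n nat)) :=
  build (fun i => let! l := op (f i) in rank_tableT l).

Definition rankT n (t : array n nat) (a : option 'I_n) : timed nat :=
  if a is Some x then get t x else op n.

(* The state of the implementation of GS-M: 'pending' is the increasing list of
   single men and 'proposals' records the proposals (man, woman) made so far,
   latest first. *)
Record run_state (n : nat) := RunState {
  remaining : array n (seq 'I_n);
  husband : array n (option 'I_n);
  pending : seq 'I_n;
  proposals : seq ('I_n * 'I_n) }.

(* The fuel bounds the number of proposals; the loop stops when no man is
   single. *)
Fixpoint gs_loopT n (fuel : nat) (t : array n (array n nat)) (s : run_state n)
    : timed (run_state n) :=
  let! _ := op tt in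
  match fuel, pending s with
  | fuel'.+1, m :: single =>
    let! l := get (remaining s) m in
    if l is w :: r then
      let! rem := put (remaining s) m r in
      let! h := get (husband s) w in
      let! tw := get t w in
      let! a := get tw m in
      let! b := rankT tw h in
      let! accepted := op (a < b) in
      if accepted then
        let! hus := put (husband s) w (Some m) in
        let! single' := (if h is Some m' then insertT m' single
                         else ret single) in
        gs_loopT fuel' t (RunState rem hus single' ((m, w) :: proposals s))
      else
        let! single' := insertT m single in
        gs_loopT fuel' t (RunState rem (husband s) single'
                            ((m, w) :: proposals s))
    else gs_loopT fuel' t (RunState (remaining s) (husband s) single
                             (proposals s))
  | _, _ => ret s
  end.

(* GS-M: the resulting matching and the proposals made, latest first. *)
Definition gsT n (Q : strategy n)
    : timed (matching n * seq ('I_n * 'I_n)) :=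
  let! t := rank_tablesT (women Q) in
  let! rem := build (fun m => op (men Q m)) in
  let! hus := build (fun _ : 'I_n => ret (@None 'I_n)) in
  let! all_men := indices n in
  let! fuel := op (n * n) in
  let! s := gs_loopT fuel t (RunState rem hus all_men [::]) in
  ret (husband s, proposals s).

(* The men who propose to w, in chronological order. *)
Definition proposersT n (w : 'I_n) (log : seq ('I_n * 'I_n))
    : timed (seq 'I_n) :=
  foldT (fun r p => let! b := op (p.2 == w) in
                    ret (if b then p.1 :: r else r))
        [::] log.

Definition wivesT n (mu : matching n) : timed (array n (option 'I_n)) :=
  let! t0 := build (fun _ : 'I_n => ret (@None 'I_n)) in
  let! ws := indices n in
  foldT (fun t w => let! h := get mu w in
                    if h is Some m then put t m (Some w) else ret t)
        t0 ws.

Definition stableT n (P : strategy n) (mu : matching n) : timed bool :=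
  let! tm := rank_tablesT (men P) in
  let! tw := rank_tablesT (women P) in
  let! wf := wivesT mu in
  let! all_men := indices n in
  let! all_women := indices n in
  let! blocked :=
    hasT (fun m => hasT (fun w =>
      let! rm := get tm m in
      let! a := get rm w in
      let! mw := get wf m in
      let! b := rankT rm mw in
      let! c1 := op (a < b) in
      let! rw := get tw w in
      let! a' := get rw m in
      let! mh := get mu w in
      let! b' := rankT rw mh in
      let! c2 := op (a' < b') in
      op (c1 && c2)) all_women) all_men in
  op (~~ blocked).

(* The list l(I; w): the men of I first, then the others in their order in l. *)
Definition promoteT n (I l : seq 'I_n) : timed (seq 'I_n) :=
  let! r := filterT (fun m => let! b := memT m I in op (~~ b)) l in
  catT I r.

(* The pair (N, L); each list of L is stored with its first man. *)
Definition explored (n : nat) := (seq 'I_n * seq ('I_n * seq 'I_n))%type.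

(* exploreT fuel Q w x I l NL is Explore on the list l = Q(x, I; w).  N and L are
   threaded through the nested calls, so "y not in N" is tested when y is
   reached.  Each nested call has enlarged N, so the depth is at most n and fuel
   n suffices. *)
Fixpoint exploreT n (fuel : nat) (Q : strategy n) (w x : 'I_n) (I l : seq 'I_n)
    (NL : explored n) : timed (explored n) :=
  let! _ := op tt in
  if fuel is fuel'.+1 then
    let! Q' := replaceT Q w l in
    let! g := gsT Q' in
    let! s := proposersT w g.2 in
    let! A := afterT x s in
    foldT (fun (NL : explored n) y =>
             let! known := memT y NL.1 in
             if known then ret NL else
               let! lw := op (women Q w) in
               let! l' := promoteT (y :: x :: I) lw in
               exploreT fuel' Q w y (x :: I) l' (y :: NL.1, (y, l') :: NL.2))
          NL A
  else ret NL.

Definition subroutineT n (Q : strategy n) (w : 'I_n) : timed (explored n) :=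
  let! g := gsT Q in
  let! s := proposersT w g.2 in
  if s is x1 :: _ then
    let! lw := op (women Q w) in
    let! l1 := promoteT [:: x1] lw in
    exploreT n Q w x1 [::] l1 ([:: x1], [:: (x1, l1)])
  else ret ([::], [::]).

Variant answer := Yes | No.

Definition algorithmT n (P Q : strategy n) : timed answer :=
  let! g := gsT Q in
  let! all_women := indices n in
  let! found :=
    hasT (fun w =>
      let! NL := subroutineT Q w in
      let! lw := op (women P w) in
      let! t := rank_tableT lw in
      let! h := get g.1 w in
      let! b := rankT t h in
      let! N' := filterT (fun m => let! a := get t m in op (a < b)) NL.1 in
      hasT (fun m =>
        let! o := lookupT m NL.2 in
        if o is Some l then
          let! Q' := replaceT Q w l in
          let! g' := gsT Q' in
          stableT P g'.1
        else ret false) N') all_women in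
  ret (if found then No else Yes).

(* Main.v *)
(* Once a man m has proposed to w, moving him to the front of her list makes him
   her final husband, and since w compares only men who have proposed to her,
   the run is unchanged up to his proposal; hence every list found by Explore
   wins its first man.  Conversely the final matching depends only on the
   husband w gets: if two lists have the same first man and both win him, each
   output is stable for the other list, so man-optimality makes them equal.
   Hence testing one list per man suffices, and every man y who proposes to w
   under some list is found: let x be the man w prefers in that list among those
   who proposed before y, found by induction.  With x in front y still proposes
   to w, so he also does under the list that Explore recorded for x.

   For the running time, at any moment at most one single man has already
   proposed, and he has smaller index than all other single men, so the sorted
   list of single men is updated in constant time and GS-M takes O(n^2). *)

Require Import Defs.
From mathcomp Require Import all_boot zify.

Set Implicit Arguments.
Unset Strict Implicit.
Unset Printing Implicit Defensive.

(** * Complete lists, and ranks in a list with a given tail *)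

Lemma complete_uniq n (l : seq 'I_n) : complete_list l -> uniq l.
Proof. by move/perm_uniq->; apply: enum_uniq. Qed.

Lemma complete_mem n (l : seq 'I_n) x : complete_list l -> x \in l.
Proof. by move/perm_mem->; rewrite mem_enum. Qed.

Lemma complete_size n (l : seq 'I_n) : complete_list l -> size l = n.
Proof. by move/perm_size->; rewrite size_enum_ord. Qed.

Lemma complete_index n (l : seq 'I_n) x : complete_list l -> index x l < n.
Proof. by move=> cl; rewrite -{2}(complete_size cl) index_mem complete_mem. Qed.

Lemma complete_index_inj n (l : seq 'I_n) x y :
  complete_list l -> index x l = index y l -> x = y.
Proof.
by move=> cl xy; rewrite -(nth_index x (complete_mem x cl)) xy nth_index ?complete_mem.
Qed.

Lemma complete_replace n (Q : strategy n) w l :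
  complete Q -> complete_list l -> complete (replace Q w l).
Proof. by case=> cm cw cl; split=> //= v; case: eqP. Qed.

(** In the sequel [x :: s] is a man's fiancée followed by the women he has not tried. This lemma and
    the next turn membership in [s] into a comparison of ranks. *)
Lemma suffix_cons_index (T : eqType) (s l : seq T) x y :
  uniq l -> suffix (x :: s) l -> y \notin s -> y \in l -> index y l <= index x l.
Proof.
move=> ul /suffixP[t def_l] ys; move: ul; rewrite {}def_l.
rewrite cat_uniq /= negb_or => /and4P[_ /andP[xt _] xs _].
rewrite mem_cat inE (negPf ys) orbF !index_cat (negPf xt) /= eqxx addn0.
by case: ifP => [yt _|_ /=]; [rewrite ltnW ?index_mem | move/eqP->; rewrite eqxx addn0].
Qed.

Lemma suffix_cons_index_lt (T : eqType) (s l : seq T) x y :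
  uniq l -> suffix (x :: s) l -> y \in s -> index x l < index y l.
Proof.
move=> ul /suffixP[t def_l] ys; move: ul; rewrite {}def_l.
rewrite cat_uniq /= negb_or => /and4P[_ /andP[xt sxt] xs _].
rewrite !index_cat (negPf xt) /= eqxx addn0.
have /negPf-> : y \notin t by apply: contra sxt => yt; apply/hasP; exists y.
have /negPf-> : x != y by apply: contraNneq xs => ->.
by rewrite addnS ltnS leq_addr.
Qed.

(** * The Gale-Shapley algorithm *)

(** Unlike in [gs_step], no test on [untried] is made, so that this is the [pending] list of the
    implementation. On valid states the test always succeeds, by [single_untried]. *)
Definition singles n (s : gs_state n) : seq 'I_n :=
  [seq m <- enum 'I_n | wife (engaged s) m == None].

Definition next_proposal n (s : gs_state n) : option ('I_n * 'I_n) :=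
  if singles s is m :: _ then
    if untried s m is v :: _ then Some (m, v) else None
  else None.

Definition propose n (Q : strategy n) (s : gs_state n) m v : gs_state n :=
  GsState [ffun i => if i == m then behead (untried s i) else untried s i]
          [ffun u => if (u == v) && prefers (women Q v) (Some m) (engaged s v)
                     then Some m else engaged s u].

(* The last clause says that at most one single man has already proposed, and
   that he is then the next to propose. *)
Record valid n (Q : strategy n) (s : gs_state n) : Prop := Valid {
  untried_suffix : forall m, suffix (untried s m) (men Q m);
  engaged_suffix : forall v m,
    engaged s v = Some m -> suffix (v :: untried s m) (men Q m);
  engaged_best : forall v m, v \notin untried s m ->
    position (women Q v) (engaged s v) <= index m (women Q v);
  engaged_free : forall v m, engaged s v = Some m ->
    all (fun i : 'I_n => m < i) (behead (singles s)) }.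

Section ValidStates.

Variables (n : nat) (Q : strategy n).
Hypothesis cQ : complete Q.

Let men_uniq m : uniq (men Q m).
Proof. by case: cQ => cm _; apply: complete_uniq. Qed.

Let men_mem m v : v \in men Q m.
Proof. by case: cQ => cm _; apply: complete_mem. Qed.

Lemma engaged_untried s v m : valid Q s -> engaged s v = Some m -> v \notin untried s m.
Proof.
move=> Vs /(engaged_suffix Vs) /suffix_uniq /(_ (men_uniq m)) /=.
by case/andP.
Qed.

(** The fiancée of [m] is the entry of his list just before [untried s m], hence determined by
    [m]. *)
Lemma engaged_inj s u v m :
  valid Q s -> engaged s u = Some m -> engaged s v = Some m -> u = v.
Proof.
move=> Vs /(engaged_suffix Vs) + /(engaged_suffix Vs).
by rewrite !suffixE /= => /eqP-> /eqP[].
Qed.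

Lemma wifeP s m v :
  valid Q s -> (wife (engaged s) m == Some v) = (engaged s v == Some m).
Proof.
move=> Vs; rewrite /wife; case: pickP => [u /eqP su|no].
  apply/eqP/eqP=> [[<-] // | sv]; congr Some; exact: engaged_inj Vs su sv.
by apply/esym/negbTE/negbT/no.
Qed.

Lemma singlesP (s : gs_state n) m :
  reflect (forall v, engaged s v <> Some m) (m \in singles s).
Proof.
rewrite mem_filter mem_enum andbT /wife.
case: pickP => [u su|no]; constructor; first by move/(_ u); move/eqP: su.
by move=> v /eqP; rewrite no.
Qed.

(* If a single man had no woman left, all women would be engaged, to n distinct
   men other than him. *)
Lemma single_untried s m : valid Q s -> m \in singles s -> untried s m != [::].
Proof.
move=> Vs /singlesP single; apply/eqP => um.
(* Every woman has been tried by [m], so her fiancé has position below [n], whereas [None] has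
   position [n]. The default of [odflt] is therefore never reached. *)
have eng v : engaged s v = Some (odflt m (engaged s v)).
  have /= := engaged_best Vs (v := v) (m := m); rewrite um => /(_ isT).
  by case: (engaged s v) => //= /leq_ltn_trans-/(_ _ (complete_index m (cQ.2 v)));
    rewrite complete_size ?ltnn //; case: cQ.
have inj : injective (fun v => odflt m (engaged s v)).
  move=> u v /= uv; apply: (engaged_inj Vs (eng u)); rewrite uv; exact: eng.
by have /codomP[v def_m] := injF_onto inj m; apply: (single v); rewrite eng -def_m.
Qed.

Lemma next_proposalP s m v : valid Q s -> next_proposal s = Some (m, v) ->
  [/\ exists r, singles s = m :: r, m \in singles s, exists r, untried s m = v :: r
    & v \in untried s m].
Proof.
move=> Vs; rewrite /next_proposal; case ss: (singles s) => [//|m' r].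
case um: (untried s m') => [//|v' r'] [<- <-]; split; first by exists r.
- by rewrite mem_head.
- by exists r'.
- by rewrite um mem_head.
Qed.

Lemma next_proposal_None s : valid Q s -> next_proposal s = None -> singles s = [::].
Proof.
move=> Vs; rewrite /next_proposal; case ss: (singles s) => [//|m r].
have := @single_untried s m Vs; rewrite ss mem_head => /(_ isT).
by case: (untried s m).
Qed.

Lemma gs_stepE s : valid Q s ->
  gs_step Q s = if next_proposal s is Some (m, v) then propose Q s m v else s.
Proof.
move=> Vs; rewrite /gs_step /next_proposal.
have -> : [seq m <- enum 'I_n | (wife (engaged s) m == None) && (untried s m != [::])]
          = singles s.
  apply: eq_filter => m; case: eqP => //= wm; apply: single_untried => //.
  by rewrite mem_filter wm mem_enum.
case: (singles s) => [//|m r]; case um: (untried s m) => [//|v r'].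
rewrite /propose; congr GsState; apply/ffunP => i; rewrite !ffunE.
  by case: eqP => // ->; rewrite um.
Qed.

Lemma singles_sorted s : sorted (fun i j : 'I_n => i < j) (singles s).
Proof.
apply: sorted_filter; first by move=> i j k; apply: ltn_trans.
have := iota_ltn_sorted 0 n; rewrite -val_enum_ord sorted_map.
by apply: sub_sorted.
Qed.

Lemma engaged_propose s m v : engaged (propose Q s m v) v =
  if prefers (women Q v) (Some m) (engaged s v) then Some m else engaged s v.
Proof. by rewrite ffunE eqxx. Qed.

Lemma engaged_propose_neq s m v u :
  u != v -> engaged (propose Q s m v) u = engaged s u.
Proof. by rewrite ffunE => /negPf->. Qed.

Lemma mem_singles_propose s m v r i : valid Q s -> singles s = m :: r ->
  prefers (women Q v) (Some m) (engaged s v) ->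
  (i \in singles (propose Q s m v)) = (i \in r) || (engaged s v == Some i).
Proof.
move=> Vs ss acc; have := singles_sorted s.
rewrite ss /= path_sortedE; last by move=> ? ? ?; apply: ltn_trans.
case/andP=> /allP m_r _.
apply/singlesP/orP=> [single|[ir|/eqP sv] u].
- have [_|vi] := eqVneq (engaged s v) (Some i); [by right | left].
  have: i \in singles s.
    apply/singlesP => u su; apply: (single u); rewrite engaged_propose_neq //.
    by apply: contraNneq vi => uv; rewrite -uv su.
  rewrite ss inE => /orP[/eqP im|//]; case: (single v).
  by rewrite engaged_propose acc im.
- have i_s : i \in singles s by rewrite ss inE ir orbT.
  have [->|uv] := eqVneq u v; last first.
    by rewrite engaged_propose_neq //; move: u {uv}; apply/singlesP.
  by rewrite engaged_propose acc => -[mi]; have := m_r i ir; rewrite mi ltnn.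
- have [->|uv] := eqVneq u v.
    rewrite engaged_propose acc => -[mi].
    have : m \in singles s by rewrite ss mem_head.
    by move/singlesP/(_ v); rewrite sv mi.
  rewrite engaged_propose_neq // => su; case/eqP: uv; exact: engaged_inj Vs su sv.
Qed.

(** By [engaged_free] a displaced fiancé precedes all remaining single men, so he becomes the head
    of the list. This is why sorted insertion takes constant time in [gs_loopT]. *)
Lemma singles_propose s m v r : valid Q s -> singles s = m :: r ->
  singles (propose Q s m v) =
    if prefers (women Q v) (Some m) (engaged s v)
    then if engaged s v is Some m' then m' :: r else r else m :: r.
Proof.
move=> Vs ss; have := singles_sorted s; rewrite ss /= => m_r.
case: ifP => [acc|rej]; last first.
  rewrite -ss; apply: eq_filter => i; congr (_ == _); rewrite /wife.
  by apply: eq_pick => u /=; rewrite ffunE rej andbF.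
have tr : transitive (fun i j : 'I_n => i < j) by move=> ? ? ?; apply: ltn_trans.
apply: (irr_sorted_eq tr) => [i|||i]; first by rewrite /= ltnn.
- exact: singles_sorted.
- case sv: (engaged s v) => [m'|]; last exact: path_sorted m_r.
  rewrite /= path_sortedE // (path_sorted m_r) andbT.
  by have := engaged_free Vs sv; rewrite ss.
rewrite (mem_singles_propose _ Vs ss acc); case: (engaged s v) => [m'|]; last by rewrite orbF.
by rewrite inE orbC eq_sym; congr orb; rewrite eq_sym.
Qed.

Lemma prefers_SomeE (l : seq 'I_n) m h :
  prefers l (Some m) h = (index m l < position l h).
Proof. by []. Qed.

Lemma valid_propose s m v :
  valid Q s -> next_proposal s = Some (m, v) -> valid Q (propose Q s m v).
Proof.
move=> Vs /(next_proposalP Vs)[[r ss] m_s [r' um] v_m].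
have sub i u : u \in untried (propose Q s m v) i -> u \in untried s i.
  by rewrite ffunE; case: eqP => // -> /mem_behead.
split=> [i|u i|u i|u i].
- rewrite ffunE; case: eqP => [->|_]; last exact: untried_suffix.
  apply: suffix_trans (untried_suffix Vs m); rewrite um; exact: suffix_cons.
- have [->|uv] := eqVneq u v; last first.
    rewrite engaged_propose_neq // => su; rewrite ffunE.
    case: eqP => [im|_]; last exact: engaged_suffix.
    by move/singlesP: m_s => /(_ u); rewrite su im.
  rewrite engaged_propose; case: ifP => [_ [<-]|_ sv].
    by rewrite ffunE eqxx um /= -um; apply: untried_suffix.
  rewrite ffunE; case: eqP => [im|_]; last exact: engaged_suffix.
  by move/singlesP: m_s => /(_ v); rewrite sv im.
- have [-> ui|uv] := eqVneq u v; last first.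
    rewrite engaged_propose_neq // => ui; apply: (engaged_best Vs).
    apply: contra ui; rewrite ffunE; case: eqP => // ->.
    by rewrite um inE (negPf uv).
  rewrite engaged_propose prefers_SomeE.
  have [->|im] := eqVneq i m; first by case: ltnP.
  have: v \notin untried s i by move: ui; rewrite ffunE (negPf im).
  by move/(engaged_best Vs); case: ltnP => // lt; apply/leq_trans/ltnW.
rewrite (singles_propose v Vs ss).
have all_r j w : engaged s w = Some j -> all (fun k : 'I_n => j < k) r.
  by move/(engaged_free Vs); rewrite ss.
have m_r : all (fun k : 'I_n => m < k) r.
  have := singles_sorted s; rewrite ss /= path_sortedE; first by case/andP.
  by move=> ? ? ?; apply: ltn_trans.
(* A man engaged after the proposal is [m] or was engaged before; either way he precedes all of [r].
   The new list of singles is [r], possibly with one man in front. *)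
move=> eng; have i_r : all (fun k : 'I_n => i < k) r.
  have [uv|uv] := eqVneq u v; last first.
    by move: eng; rewrite engaged_propose_neq //; apply: all_r.
  by move: eng; rewrite uv engaged_propose; case: ifP => [_ [<-]|_ /all_r].
case: ifP => // _; case: (engaged s v) => //.
by apply/allP => k /mem_behead; apply: (allP i_r).
Qed.

Lemma valid_start : valid Q (gs_start Q).
Proof.
split=> [m|v m|v m|v m]; rewrite /= ffunE ?suffix_refl //.
by rewrite men_mem.
Qed.

(** * The run of GS-M, its termination, stability and man-optimality *)

Definition state k : gs_state n := iter k (gs_step Q) (gs_start Q).

Lemma valid_state k : valid Q (state k).
Proof.
elim: k => [|k Vk]; first exact: valid_start.
rewrite /= gs_stepE //; case sk: (next_proposal (state k)) => [[m v]|] //.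
exact: valid_propose.
Qed.

Lemma stateS k : state k.+1 =
  if next_proposal (state k) is Some (m, v) then propose Q (state k) m v else state k.
Proof. by rewrite -gs_stepE //; apply: valid_state. Qed.

(** While the run goes on, the number of steps done plus the total length of the untried lists stays
    [n * n], so after [n * n] steps nothing is left to try. *)
Lemma next_proposal_end : next_proposal (state (n * n)) = None.
Proof.
suff H k : next_proposal (state k) = None \/ k + \sum_m size (untried (state k) m) = n * n.
  have [//|/eqP] := H (n * n).
  rewrite -[X in _ == X]addn0 eqn_add2l sum_nat_eq0 => /forallP un.
  rewrite /next_proposal; case: (singles _) => // m _.
  by move: (un m); case: (untried _ m).
elim: k => [|k IHk].
  right; rewrite add0n -[X in _ = X * _]card_ord -sum_nat_const.
  by apply: eq_bigr => m _; rewrite ffunE complete_size //; case: cQ.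
rewrite stateS; case sk: (next_proposal (state k)) IHk => [[m v]|]; last by left.
case=> // <-; right; rewrite addSnnS; congr addn.
have [_ _ [r um] _] := next_proposalP (valid_state k) sk.
rewrite (bigD1 m) //= [in RHS](bigD1 m) //= ffunE eqxx um /= -addSn; congr addn.
by apply: eq_bigr => i /negPf im; rewrite ffunE im.
Qed.

Lemma singles_end : singles (state (n * n)) = [::].
Proof. exact: next_proposal_None (valid_state _) next_proposal_end. Qed.

Lemma mu_wife m : exists v, mu Q v = Some m.
Proof.
have: m \notin singles (state (n * n)) by rewrite singles_end.
case: (boolP [exists v, mu Q v == Some m]) => [/existsP[v /eqP]|]; first by exists v.
by rewrite negb_exists => /forallP no /singlesP[]; move=> v /eqP; apply/negP/no.
Qed.

Lemma mu_inj u v m : mu Q u = Some m -> mu Q v = Some m -> u = v.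
Proof. exact: engaged_inj (valid_state (n * n)). Qed.

Lemma mu_wifeP m v : (wife (mu Q) m == Some v) = (mu Q v == Some m).
Proof. exact: wifeP (valid_state (n * n)). Qed.

Lemma mu_husband v : exists m, mu Q v = Some m.
Proof.
pose f m := odflt v (wife (mu Q) m).
have fP m : wife (mu Q) m = Some (f m).
  by have [u /eqP] := mu_wife m; rewrite -mu_wifeP /f => /eqP->.
have f_inj : injective f.
  move=> m m' ff; have: wife (mu Q) m = Some (f m') by rewrite fP ff.
  move/eqP; have /eqP := fP m'; rewrite !mu_wifeP => /eqP-> /eqP[//].
have /codomP[m def_v] := injF_onto f_inj v; exists m; apply/eqP.
by rewrite -mu_wifeP fP -def_v.
Qed.

(** By [engaged_suffix] the women [m] has not tried are those after his final wife. Hence the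
    matching and the men's lists determine who has proposed to whom. *)
Lemma untried_mu m v w : mu Q v = Some m ->
  (w \notin untried (state (n * n)) m) = (index w (men Q m) <= index v (men Q m)).
Proof.
move=> muv; have sfx := engaged_suffix (valid_state (n * n)) muv.
apply/idP/idP => [wn|]; first exact: suffix_cons_index sfx wn (men_mem m w).
by rewrite leqNgt; apply: contra => /(suffix_cons_index_lt (men_uniq m) sfx).
Qed.

Lemma mu_stable : stable Q (mu Q).
Proof.
case=> m [w []]; have [v muv] := mu_wife m.
have /eqP -> : wife (mu Q) m == Some v by rewrite mu_wifeP muv.
rewrite prefers_SomeE /= => /ltnW; rewrite -(untried_mu _ muv).
by move/(engaged_best (valid_state (n * n))); rewrite prefers_SomeE leqNgt => /negP.
Qed.

(* No man is ever rejected by his partner in a stable matching: at the first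
   such rejection the rival would form a blocking pair with her. *)
Lemma mu_optimal (nu : matching n) m u v :
  (forall m, exists v, nu v = Some m) ->
  (forall m v, (wife nu m == Some v) = (nu v == Some m)) -> stable Q nu ->
  mu Q u = Some m -> nu v = Some m -> index u (men Q m) <= index v (men Q m).
Proof.
move=> nu_wife nu_wifeP nu_stable.
have nu_block i a b : nu a = Some i -> index b (men Q i) < index a (men Q i) ->
    position (women Q b) (nu b) <= index i (women Q b).
  move=> nua ba; rewrite leqNgt; apply/negP => lt; apply: nu_stable.
  exists i, b; split=> //; have /eqP-> : wife nu i == Some a by rewrite nu_wifeP nua.
  by rewrite prefers_SomeE.
(* Invariant: a man has still to try his [nu]-wife or is engaged to her; he is never turned away by
   her. *)
suff H k i a : nu a = Some i ->
    a \in untried (state k) i \/ engaged (state k) a = Some i.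
  move=> muu nuv; have sfx := engaged_suffix (valid_state (n * n)) muu.
  case: (H (n * n) m v nuv) => [vm|muv]; last by rewrite (mu_inj muu muv).
  exact: ltnW (suffix_cons_index_lt (men_uniq m) sfx vm).
elim: k i a => [|k IHk] i a nua; first by left; rewrite ffunE.
rewrite stateS; have Vk := valid_state k.
case sk: (next_proposal (state k)) => [[m0 v0]|]; last exact: IHk.
have [_ /singlesP m0_single [r um] v0m0] := next_proposalP Vk sk.
case: (IHk i a nua) => [ai|sa].
  have [im|im] := eqVneq i m0; last by left; rewrite ffunE (negPf im).
  have [av|av] := eqVneq a v0; last first.
    left; rewrite ffunE im eqxx; move: ai; rewrite im um /= inE (negPf av) //.
  right; rewrite av engaged_propose prefers_SomeE im.
  (* Suppose [v0] refuses [m0], her [nu]-husband. By the invariant her fiancé [m1] has not yet tried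
     his own [nu]-wife, so he prefers [v0] to her, and [m1] and [v0] block [nu]. *)
  case: ltnP => // le; exfalso; subst i a.
  case sv: (engaged (state k) v0) le => [m1|] /=; last first.
    by rewrite leqNgt complete_size ?complete_index //; case: cQ.
  move=> le; have sfx1 := engaged_suffix Vk sv.
  have m10 : m1 <> m0 by move=> e; apply: (m0_single v0); rewrite sv e.
  have [v1 nuv1] := nu_wife m1; case: (IHk m1 v1 nuv1) => [v1m1|sv1]; last first.
    by have v10 := engaged_inj Vk sv sv1; move: nua; rewrite v10 nuv1 => -[].
  have := nu_block _ _ _ nuv1 (suffix_cons_index_lt (men_uniq m1) sfx1 v1m1).
  rewrite nua /= => ge; apply: m10; apply: (complete_index_inj (cQ.2 v0)).
  by apply/eqP; rewrite eqn_leq le ge.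
have [av|av] := eqVneq a v0; last by right; rewrite engaged_propose_neq.
subst a; rewrite engaged_propose; case: ifP => [acc|_]; last by right.
(* Suppose [v0] leaves her [nu]-husband [i] for [m0]. The [nu]-wife of [m0] comes after [v0] in his
   list, so [m0] and [v0] block [nu]. *)
exfalso; have [v1 nuv1] := nu_wife m0.
case: (IHk m0 v1 nuv1) => [v1m0|]; last exact: m0_single.
have v10 : v1 <> v0.
  move=> e; move: nuv1; rewrite e nua => -[im0]; apply: (m0_single v0).
  by rewrite sa im0.
have v1r : v1 \in r by move: v1m0; rewrite um inE; case: eqP.
have sfx0 := untried_suffix Vk m0; rewrite um in sfx0.
have := nu_block _ _ _ nuv1 (suffix_cons_index_lt (men_uniq m0) sfx0 v1r).
by rewrite nua leqNgt; move: acc; rewrite sa /prefers /= => ->.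
Qed.

(** * The proposals made so far, in chronological order *)

Definition history k : seq ('I_n * 'I_n) :=
  pmap (fun i => next_proposal (state i)) (iota 0 k).

Lemma historyS k : history k.+1 =
  if next_proposal (state k) is Some p then rcons (history k) p else history k.
Proof.
rewrite /history -{1}addn1 iotaD pmap_cat /= add0n.
by case: (next_proposal _) => [p|] /=; rewrite ?cats1 ?cats0.
Qed.

Lemma mem_history k m v : ((m, v) \in history k) = (v \notin untried (state k) m).
Proof.
elim: k => [|k IHk]; first by rewrite in_nil ffunE men_mem.
rewrite historyS stateS; case sk: (next_proposal _) => [[m0 v0]|] //.
have [_ _ [r um] _] := next_proposalP (valid_state k) sk.
rewrite mem_rcons inE IHk xpair_eqE ffunE.
have [->|//] := eqVneq m m0; rewrite um inE negb_or /=.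
have [->|//] := eqVneq v v0.
have := suffix_uniq (untried_suffix (valid_state k) m0) (men_uniq m0).
by rewrite um => /andP[-> _].
Qed.

Lemma history_uniq k : uniq (history k).
Proof.
elim: k => // k IHk; rewrite historyS; case sk: (next_proposal _) => [[m v]|] //.
have [_ _ _ vm] := next_proposalP (valid_state k) sk.
by rewrite rcons_uniq IHk mem_history vm.
Qed.

Lemma size_history k : size (history k) <= k.
Proof.
by rewrite size_pmap (leq_trans (count_size _ _)) // size_iota.
Qed.

Definition suitors_by w k : seq 'I_n := [seq p.1 | p <- history k & p.2 == w].

Lemma mem_suitors_by w k m :
  (m \in suitors_by w k) = (w \notin untried (state k) m).
Proof.
rewrite -mem_history; apply/mapP/idP => [[[m' w']]|mw].
  by rewrite mem_filter /= => /andP[/eqP->] + ->.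
by exists (m, w); rewrite // mem_filter eqxx.
Qed.

Lemma suitors_by_uniq w k : uniq (suitors_by w k).
Proof.
rewrite map_inj_in_uniq ?filter_uniq ?history_uniq // => -[m u] [m' u'].
by rewrite !mem_filter /= => /andP[/eqP-> _] /andP[/eqP-> _] ->.
Qed.

Lemma suitors_byS w k : suitors_by w k.+1 =
  if next_proposal (state k) is Some (m, v) then
    if v == w then rcons (suitors_by w k) m else suitors_by w k
  else suitors_by w k.
Proof.
rewrite /suitors_by historyS; case: (next_proposal _) => [[m v]|] //.
by rewrite filter_rcons /=; case: ifP => // _; rewrite map_rcons.
Qed.

End ValidStates.

(** * Replacing the list of one woman *)

Definition same_but n w (Q Q' : strategy n) : Prop :=
  men Q =1 men Q' /\ forall v, v != w -> women Q v = women Q' v.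

Lemma same_but_sym n w (Q Q' : strategy n) : same_but w Q Q' -> same_but w Q' Q.
Proof. by case=> eq_men eq_women; split=> [m|v vw]; rewrite ?eq_women. Qed.

Lemma same_but_replace n w (Q : strategy n) l l' :
  same_but w (replace Q w l) (replace Q w l').
Proof. by split=> //= v /negPf->. Qed.

Lemma same_but_replacer n w (Q : strategy n) l : same_but w Q (replace Q w l).
Proof. by split=> //= v /negPf->. Qed.

Definition same_order (T : eqType) (s l l' : seq T) : Prop :=
  {in s &, forall a b, (index a l < index b l) = (index a l' < index b l')}.

Lemma index_filter_lt (T : eqType) (p : pred T) a b (l : seq T) : p a -> p b ->
  (index a (filter p l) < index b (filter p l)) = (index a l < index b l).
Proof.
move=> pa pb; elim: l => //= x l IHl.
case px: (p x) => /=; last first.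
  have /negPf-> : x != a by apply: contraFneq px => ->.
  by have /negPf-> : x != b by apply: contraFneq px => ->.
by case: eqP => // _; case: eqP => // _; rewrite !ltnS.
Qed.

Definition to_front (T : eqType) (x : T) l := x :: filter (predC1 x) l.

Lemma to_front_order (T : eqType) (x : T) s l : x \notin s ->
  same_order s l (to_front x l).
Proof.
have neq a : x \notin s -> a \in s -> a != x by move=> xs; apply: contraTneq => ->.
move=> xs a b /(neq a xs) ax /(neq b xs) bx.
by rewrite /= !(eq_sym x) (negPf ax) (negPf bx) ltnS index_filter_lt.
Qed.

(** No member of [s] is ahead of [x] in [l], so putting [x] first changes no comparison within [s].
    Unlike in [to_front_order], [x] may itself belong to [s]. *)
Lemma to_front_best_order (T : eqType) (x : T) s l :
  x \in l -> {in s, forall a, index x l <= index a l} -> same_order s l (to_front x l).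
Proof.
move=> xl best a b sa sb.
have eq_x c : index c l = index x l -> c = x.
  move=> cx; have cl : c \in l by rewrite -index_mem cx index_mem.
  by rewrite -(nth_index x cl) cx nth_index.
have [->|ax] := eqVneq a x; rewrite /= ?eqxx ?(eq_sym x).
  have [->|bx] := eqVneq b x; first by rewrite !ltnn.
  by rewrite ltn_neqAle best // andbT eq_sym; apply: contraNneq bx => /eq_x->.
have [->|bx] := eqVneq b x; first by rewrite ltnNge best.
by rewrite (negPf ax) ltnS index_filter_lt.
Qed.

Lemma complete_to_front n x (l : seq 'I_n) : complete_list l -> complete_list (to_front x l).
Proof.
move=> cl; apply: perm_trans (cl); rewrite perm_sym.
by have /perm_to_rem := complete_mem x cl; rewrite rem_filter // complete_uniq.
Qed.

Definition suitors n (Q : strategy n) w := suitors_by Q w (n * n).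

Section Replacement.

Variables (n : nat) (w : 'I_n).
Implicit Types Q : strategy n.

Lemma suitors_by_prefix Q j k : complete Q -> j <= k ->
  prefix (suitors_by Q w j) (suitors_by Q w k).
Proof.
move=> cQ /subnK <-; elim: (k - j) => [|i IHi]; first exact: prefix_refl.
apply: prefix_trans IHi _; rewrite addSn suitors_byS //.
case: (next_proposal _) => [[m v]|]; last exact: prefix_refl.
by case: ifP; rewrite ?prefix_rcons ?prefix_refl.
Qed.

Lemma suitors_by_subset Q j k : complete Q -> j <= k ->
  {subset suitors_by Q w j <= suitors_by Q w k}.
Proof.
move=> cQ /(suitors_by_prefix cQ) /prefixP[s ->] x xs.
by rewrite mem_cat xs.
Qed.

(* A woman's list is consulted only to compare men who have proposed to her. *)
Lemma state_same_order Q Q' k : complete Q -> complete Q' -> same_but w Q Q' ->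
  same_order (suitors_by Q w k) (women Q w) (women Q' w) -> state Q k = state Q' k.
Proof.
move=> cQ cQ' [eq_men eq_women].
elim: k => [|k IHk] so; first by congr GsState; apply/ffunP=> m; rewrite !ffunE.
have sub := suitors_by_subset cQ (leqnSn k).
have {IHk} eq_k : state Q k = state Q' k.
  by apply: IHk => a b ak bk; apply: so; apply: sub.
rewrite !stateS // -eq_k; case sk: (next_proposal _) => [[m v]|] //.
congr GsState; apply/ffunP => u; rewrite !ffunE.
case: eqVneq => //= _; have [vw|vw] := eqVneq v w; last by rewrite eq_women.
subst v; rewrite !prefers_SomeE; case sw: (engaged _ w) => [a|] /=.
  rewrite so //; last first.
    by apply: sub; rewrite mem_suitors_by // (engaged_untried cQ (valid_state cQ k) sw).
  by rewrite suitors_byS // sk eqxx mem_rcons mem_head.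
(* A free [w] accepts anyone under both lists, since [None] has position [n]. *)
by rewrite !complete_size ?(complete_index _ (cQ.2 w)) ?(complete_index _ (cQ'.2 w)) //;
  [case: cQ' | case: cQ].
Qed.

Lemma suitors_by_same_order Q Q' k : complete Q -> complete Q' -> same_but w Q Q' ->
  same_order (suitors_by Q w k) (women Q w) (women Q' w) ->
  suitors_by Q w k = suitors_by Q' w k.
Proof.
move=> cQ cQ' sQ so; rewrite /suitors_by; congr map; congr filter.
apply: eq_in_pmap => i; rewrite mem_iota add0n => /andP[_ ik].
rewrite (state_same_order cQ cQ' sQ) // => a b ai bi.
by apply: so; apply: suitors_by_subset (ltnW ik) _ _.
Qed.

(** Suitors arrive one at a time, so there is a step at which [s1] has just been completed and [y]
    proposes next. *)
Lemma suitors_by_split Q k s1 y s2 : complete Q -> suitors_by Q w k = s1 ++ y :: s2 ->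
  exists2 j, j < k & suitors_by Q w j = s1 /\ suitors_by Q w j.+1 = rcons s1 y.
Proof.
move=> cQ; elim: k s2 => [|k IHk] s2; first by case: s1.
have next : suitors_by Q w k = s1 ++ y :: s2 -> exists2 j, j < k.+1 &
    suitors_by Q w j = s1 /\ suitors_by Q w j.+1 = rcons s1 y.
  by move/IHk => [j jk js]; exists j => //; apply: ltnW.
have := suitors_byS Q w k; case: (next_proposal _) => [[m v]|]; last by move=> ->.
case: ifP => [_|_ ->] // eq_k1; rewrite eq_k1.
case: s2 / lastP {next} => [|s2 z].
  rewrite cats1 => eq_s; have [eq_k _] := rcons_inj eq_s.
  by exists k; rewrite ?eq_k1.
rewrite -rcons_cons -rcons_cat => /rcons_inj[/IHk[j jk js] _].
by exists j => //; apply: ltnW.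
Qed.

(** Before the proposal of [y] only men of [s1] are compared by [w], so both runs agree up to that
    proposal. They may differ afterwards, hence the new tail [s2']. *)
Lemma suitors_same_order Q Q' s1 y s2 : complete Q -> complete Q' -> same_but w Q Q' ->
  suitors Q w = s1 ++ y :: s2 -> same_order s1 (women Q w) (women Q' w) ->
  exists s2', suitors Q' w = s1 ++ y :: s2'.
Proof.
move=> cQ cQ' sQ /(suitors_by_split cQ)[j jn [eq_j eq_j1]] so.
have eq_j' : suitors_by Q' w j.+1 = rcons s1 y.
  rewrite -eq_j1 !suitors_byS // -(state_same_order cQ cQ' sQ) ?eq_j //.
  by rewrite -(suitors_by_same_order cQ cQ' sQ) eq_j.
have /prefixP[s2' eq_n] := suitors_by_prefix cQ' jn.
by exists s2'; rewrite /suitors eq_n eq_j' cat_rcons.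
Qed.

Lemma mem_suitors Q m v : complete Q -> mu Q v = Some m ->
  m \in suitors Q v.
Proof.
move=> cQ muv; rewrite mem_suitors_by //.
exact: (engaged_untried cQ (valid_state cQ _) muv).
Qed.

Lemma mu_best Q v m : complete Q -> m \in suitors Q v ->
  position (women Q v) (mu Q v) <= index m (women Q v).
Proof.
by move=> cQ; rewrite mem_suitors_by //; apply/engaged_best/valid_state.
Qed.

Lemma mu_top Q x : complete Q -> index x (women Q w) = 0 -> x \in suitors Q w ->
  mu Q w = Some x.
Proof.
move=> cQ x0 /(mu_best cQ); rewrite x0 leqn0; have [m ->] := mu_husband cQ w.
by rewrite -x0 => /eqP /(complete_index_inj (cQ.2 w))->.
Qed.

(** [mu Q] is also stable for [Q']: the two strategies differ only at [w], who gets the head of her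
    list in [Q'] and so blocks with nobody. Man-optimality of [mu Q'] then gives the inequality. *)
Lemma mu_dominates Q Q' x m u v : complete Q -> complete Q' -> same_but w Q Q' ->
  index x (women Q' w) = 0 -> mu Q w = Some x ->
  mu Q' u = Some m -> mu Q v = Some m -> index u (men Q m) <= index v (men Q m).
Proof.
move=> cQ cQ' [eq_men eq_women] x0 muw; rewrite eq_men.
apply: (mu_optimal cQ') => [i|i a|[i [b [pi pb]]]]; [exact: mu_wife | exact: mu_wifeP |].
have [bw|bw] := eqVneq b w; first by move: pb; rewrite bw muw /prefers /= x0.
by apply: (mu_stable cQ); exists i, b; rewrite eq_men eq_women.
Qed.

Lemma mu_same_top Q Q' x : complete Q -> complete Q' -> same_but w Q Q' ->
  index x (women Q w) = 0 -> index x (women Q' w) = 0 ->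
  mu Q w = Some x -> mu Q' w = Some x -> mu Q = mu Q'.
Proof.
move=> cQ cQ' sQ x0 x0' muw muw'; apply/ffunP => v.
have [m muv] := mu_husband cQ v; have [u mu'u] := mu_wife cQ' m.
have le := mu_dominates cQ cQ' sQ x0' muw mu'u muv.
have := mu_dominates cQ' cQ (same_but_sym sQ) x0 muw' muv mu'u; rewrite -sQ.1 => ge.
rewrite muv -mu'u; congr (mu Q' _); apply: (complete_index_inj (cQ.1 m)).
by apply/eqP; rewrite eqn_leq le ge.
Qed.

(** By [untried_mu] the suitors of [w] are the men who rank her no lower than their wife. Their
    order of arrival may still differ, so the equality is one of sets. *)
Lemma suitors_mu Q Q' : complete Q -> complete Q' -> men Q =1 men Q' ->
  mu Q = mu Q' -> suitors Q w =i suitors Q' w.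
Proof.
move=> cQ cQ' eq_men eq_mu m; have [v muv] := mu_wife cQ m.
rewrite !mem_suitors_by // (untried_mu cQ w muv).
by rewrite (untried_mu cQ' w (v := v)) -?eq_mu -?eq_men.
Qed.

(** The husband of [w] is the best of all her suitors, so moving him to the front leaves the whole
    run unchanged. *)
Lemma mu_to_front_husband Q Q' x : complete Q -> complete Q' -> same_but w Q Q' ->
  mu Q w = Some x -> women Q' w = to_front x (women Q w) -> mu Q = mu Q'.
Proof.
move=> cQ cQ' sQ muw eq_l; congr engaged; apply: state_same_order => //.
rewrite eq_l; apply: to_front_best_order; first exact: complete_mem (cQ.2 w).
by move=> a /(mu_best cQ); rewrite muw.
Qed.

End Replacement.

(** * Lists that win a given husband, and closure of the explored set *)

Section Exploration.

Variables (n : nat) (Q : strategy n) (w : 'I_n).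
Hypothesis cQ : complete Q.

Notation suitors_on l := (suitors (replace Q w l) w).
Notation mu_on l := (mu (replace Q w l)).

Let cR l : complete_list l -> complete (replace Q w l).
Proof. exact: complete_replace. Qed.

Let women_on l : women (replace Q w l) w = l.
Proof. by rewrite /= eqxx. Qed.

(** A certificate that [w] can obtain [x]: by [witness_mu] such a list does win him. All lists
    recorded by [Explore] are of this kind. *)
Definition witness x l :=
  [/\ complete_list l, index x l = 0 & x \in suitors_on l].

Lemma witness_mu x l : witness x l -> mu_on l w = Some x.
Proof. by case=> cl x0 xl; apply: mu_top; rewrite ?women_on //; apply: cR. Qed.

Lemma witness_mu_uniq x l l' : witness x l -> witness x l' -> mu_on l = mu_on l'.
Proof.
move=> wl wl'; have [[cl x0 _] [cl' x0' _]] := (wl, wl').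
have sR := same_but_replace w Q l l'.
by apply: (mu_same_top (cR cl) (cR cl') sR (x := x)); rewrite ?women_on //; apply: witness_mu.
Qed.

(** Moving the husband obtained under [l] to the front keeps the matching and turns [l] into a
    witness for him; witnesses for one man give one matching. So a single recorded list per man can
    stand for every manipulation. *)
Lemma mu_witness x l l' : complete_list l -> mu_on l w = Some x -> witness x l' ->
  mu_on l = mu_on l'.
Proof.
move=> cl muw wl'; have cl1 := complete_to_front x cl.
have eq_mu : mu_on l = mu_on (to_front x l).
  apply: (mu_to_front_husband (cR cl) (cR cl1) (same_but_replace _ _ _ _) muw).
  by rewrite !women_on.
rewrite eq_mu; apply: witness_mu_uniq wl'; split=> //=; first by rewrite eqxx.
by apply: mem_suitors (cR cl1) _; rewrite -eq_mu.
Qed.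

(** Completeness of the exploration, by induction along the order in which the men propose to [w]
    under [l]. *)
Lemma suitors_explored (N : seq 'I_n) :
    (forall x s, suitors Q w = x :: s -> x \in N) ->
    (forall x, x \in N -> exists2 l, witness x l & {subset suitors_on l <= N}) ->
  forall l, complete_list l -> {subset suitors_on l <= N}.
Proof.
move=> first closed l cl; suff H s1 s2 : suitors_on l = s1 ++ s2 -> {subset s1 <= N}.
  by apply: (H _ [::]); rewrite cats0.
elim/last_ind: s1 s2 => [//|s1 y IHs] s2; rewrite cat_rcons => eq_s.
have sN := IHs _ eq_s.
suff yN : y \in N by move=> z; rewrite mem_rcons inE => /orP[/eqP->|/sN].
case: s1 eq_s sN {IHs} => [eq_s _|x0 s eq_s sN].
  (* The first suitor arrives before [w] compares anyone, so he does not depend on her list. *)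
  have sQ := same_but_sym (same_but_replacer w Q l).
  have [//|s2'] := suitors_same_order (cR cl) cQ sQ eq_s.
  exact: first.
set s1 := x0 :: s in eq_s sN.
have [x xs best] : exists2 x, x \in s1 & {in s1, forall a, index x l <= index a l}.
  have x0s : x0 \in s1 by rewrite mem_head.
  by case: (arg_minnP (fun a => index a l) x0s) => x xs best; exists x.
(* [x] already beats the other earlier suitors, so with [x] in front the run reaches the proposal of
   [y] unchanged. *)
have so := to_front_best_order (complete_mem x cl) best.
have cl1 := complete_to_front x cl.
have [|s2' eq_s'] :=
    suitors_same_order (cR cl) (cR cl1) (same_but_replace w Q _ _) eq_s.
  by rewrite !women_on.
have [l' wl' sl'] := closed x (sN x xs).
have wl1 : witness x (to_front x l).
  by split=> //=; rewrite ?eqxx // eq_s' mem_cat xs.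
have [cl' _ _] := wl'; apply: sl'.
(* The recorded list [l'] of [x] yields the same matching as [to_front x l], hence the same set of
   suitors, which contains [y]. *)
rewrite -(suitors_mu w (cR cl1) (cR cl') _ (witness_mu_uniq wl1 wl')) //.
by rewrite eq_s' mem_cat mem_head orbT.
Qed.

End Exploration.

(** * Values and costs of the timed computations *)

Lemma foldT_result A S (f : S -> A -> timed S) s l :
  (foldT f s l).1 = foldl (fun s a => (f s a).1) s l.
Proof. by elim: l s => //= a l IHl s; rewrite IHl. Qed.

(** Each element pays one extra step for the iteration, and the final [1] pays for finding the list
    empty. *)
Lemma foldT_cost A S (f : S -> A -> timed S) c s l :
  (forall s a, (f s a).2 <= c) -> (foldT f s l).2 <= size l * c.+1 + 1.
Proof.
move=> fc; elim: l s => //= a l IHl s.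
by have := fc s a; have := IHl (f s a).1; lia.
Qed.

Lemma hasT_result A (p : A -> timed bool) l : (hasT p l).1 = has (fun a => (p a).1) l.
Proof. by elim: l => //= a l IHl; case: (p a).1. Qed.

Lemma hasT_cost A (p : A -> timed bool) c l :
  (forall a, (p a).2 <= c) -> (hasT p l).2 <= size l * c.+1 + 1.
Proof.
move=> pc; elim: l => //= a l IHl.
by have := pc a; case: (p a).1 => /=; lia.
Qed.

Lemma filterT_result A (p : A -> timed bool) l :
  (filterT p l).1 = filter (fun a => (p a).1) l.
Proof. by elim: l => //= a l ->. Qed.

Lemma filterT_cost A (p : A -> timed bool) c l :
  (forall a, (p a).2 <= c) -> (filterT p l).2 <= size l * c.+1 + 1.
Proof. by move=> pc; elim: l => //= a l IHl; have := pc a; lia. Qed.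

Lemma catT_result A (l1 l2 : seq A) : (catT l1 l2).1 = l1 ++ l2.
Proof. by elim: l1 => //= a l ->. Qed.

Lemma catT_cost A (l1 l2 : seq A) : (catT l1 l2).2 = size l1 + 1.
Proof. by elim: l1 => //= a l ->; lia. Qed.

Lemma build_cost n T (f : 'I_n -> timed T) c :
  (forall i, (f i).2 <= c) -> (build f).2 <= n * c.+1.
Proof.
move=> fc /=; rewrite -[X in _ <= X * _]card_ord -sum_nat_const.
by apply: leq_sum => i _; rewrite addn1 ltnS.
Qed.

Lemma memT_result n (x : 'I_n) l : (memT x l).1 = (x \in l).
Proof. by rewrite /memT hasT_result -has_pred1; apply: eq_has => y /=; rewrite eq_sym. Qed.

Lemma memT_cost n (x : 'I_n) l : (memT x l).2 <= size l * 2 + 1.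
Proof. exact: hasT_cost. Qed.

Lemma afterT_result n (x : 'I_n) s t : x \notin s -> (afterT x (s ++ x :: t)).1 = t.
Proof.
elim: s => [|y s IHs] /=; first by rewrite eqxx.
by rewrite inE negb_or => /andP[/negPf-> /IHs].
Qed.

Lemma afterT_cost n (x : 'I_n) l : (afterT x l).2 <= size l * 2 + 1.
Proof. by elim: l => //= y l IHl; case: eqP => /= _; lia. Qed.

Lemma lookupT_result n (T : eqType) (x : 'I_n) (l : seq ('I_n * T)) :
  if (lookupT x l).1 is Some t then (x, t) \in l else x \notin unzip1 l.
Proof.
elim: l => //= -[y t] l IHl /=; case: eqP => [->|xy] /=; first by rewrite mem_head.
case: (lookupT x l).1 IHl => [t'|]; rewrite inE => H; first by rewrite H orbT.
by rewrite negb_or H andbT; apply/eqP.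
Qed.

Lemma lookupT_cost n T (x : 'I_n) (l : seq ('I_n * T)) : (lookupT x l).2 <= size l * 2 + 1.
Proof. by elim: l => //= -[y t] l IHl /=; case: eqP => /= _; lia. Qed.

(** The only kind of insertion that occurs during GS-M. *)
Lemma insertT_head n (x : 'I_n) l : all (fun i : 'I_n => x < i) l ->
  (insertT x l).1 = x :: l /\ (insertT x l).2 <= 2.
Proof. by case: l => //= y l /andP[-> _]. Qed.

Lemma rank_tableT_result n (l : seq 'I_n) x :
  complete_list l -> (rank_tableT l).1 x = index x l.
Proof.
move=> cl; have ul := complete_uniq cl.
rewrite /= foldT_result /=; set g := (X in foldl X).
(* Loop invariant: the men of [l1] have been entered and the counter [k] is the rank of the next
   one. *)
suff H l1 l2 : uniq (l1 ++ l2) -> forall (t : array n nat) k,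
    (forall y, y \in l1 -> t y = index y (l1 ++ l2)) -> k = size l1 ->
    forall y, y \in l1 ++ l2 -> (foldl g (t, k) l2).1 y = index y (l1 ++ l2).
  by apply: (H [::] l) => //; apply: complete_mem.
elim: l2 l1 => [|a l2 IHl] l1 u t k tk def_k y; first by rewrite cats0 => /tk->; rewrite cats0.
rewrite -cat_rcons => yl; apply: IHl => //; rewrite ?cat_rcons ?size_rcons ?def_k // => z.
rewrite mem_rcons inE ffunE => /orP[/eqP->|zl]; last first.
  rewrite tk //; case: eqP => // za; move: u; rewrite cat_uniq /= -za zl.
  by case/and3P.
rewrite eqxx index_cat; move: u; rewrite cat_uniq /= negb_or.
case/and3P=> [_ /andP[/negPf-> _] _].
by rewrite /= eqxx addn0.
Qed.

Lemma rank_tableT_cost n (l : seq 'I_n) : size l = n -> (rank_tableT l).2 <= 4 * n + 1.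
Proof.
move=> sl; rewrite /rank_tableT /=.
set f := (X in foldT X); set t0 := [ffun _ => _].
have := @foldT_cost _ _ f 2 (t0, 0) l (fun _ _ => leqnn _).
by rewrite sl sum_nat_const card_ord; move: (foldT _ _ _).2 => c; lia.
Qed.

Lemma rank_tablesT_result n (f : 'I_n -> seq 'I_n) i x :
  (forall i, complete_list (f i)) -> (rank_tablesT f).1 i x = index x (f i).
Proof. move=> cf; rewrite ffunE; apply/rank_tableT_result/cf. Qed.

Lemma rank_tablesT_cost n (f : 'I_n -> seq 'I_n) :
  (forall i, complete_list (f i)) -> (rank_tablesT f).2 <= n * (4 * n + 3).
Proof.
move=> cf; rewrite addn3; apply: build_cost => i.
have := rank_tableT_cost (complete_size (cf i)); rewrite -(leq_add2l 1).
by move/leq_trans; apply; lia.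
Qed.

Lemma rankT_result n (t : array n nat) l h : complete_list l ->
  (forall m, t m = index m l) -> (rankT t h).1 = position l h.
Proof. by move=> cl tl; case: h => [m|] /=; rewrite ?tl ?complete_size. Qed.

Lemma rankT_cost n (t : array n nat) h : (rankT t h).2 = 1.
Proof. by case: h. Qed.

(** * The implementation of GS-M: agreement with the abstract run, and quadratic cost *)

Definition run_of n (s : gs_state n) h : run_state n :=
  RunState (untried s) (engaged s) (singles s) h.

Section TimedGaleShapley.

Variables (n : nat) (Q : strategy n).
Hypothesis cQ : complete Q.

Lemma state_idle k j : next_proposal (state Q k) = None ->
  state Q (k + j) = state Q k /\ history Q (k + j) = history Q k.
Proof.
move=> idle; elim: j => [|j [eq_s eq_h]]; first by rewrite addn0.
by rewrite addnS stateS // historyS eq_s idle.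
Qed.

(** Each iteration is one step of the abstract run. It costs at most 11: eight steps up to the
    decision of the woman, one update of [husband] and two for the insertion. *)
Lemma gs_loopT_spec (t : array n (array n nat)) fuel k :
  (forall v m, t v m = index m (women Q v)) ->
  let c := gs_loopT fuel t (run_of (state Q k) (rev (history Q k))) in
  c.1 = run_of (state Q (k + fuel)) (rev (history Q (k + fuel))) /\
  c.2 <= 11 * fuel + 1.
Proof.
move=> tE; elim: fuel k => [|fuel IH] k; first by rewrite addn0.
have Vk := valid_state cQ k; rewrite /=.
case ss: (singles (state Q k)) => [|m r] /=.
  have [|-> ->] := state_idle (k := k) fuel.+1; first by rewrite /next_proposal ss.
  by rewrite /run_of ss; split.
case um: (untried (state Q k) m) => [|v l] /=.
  (* A single man always has a woman left to try, so the branch that drops him is never taken. *)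
  by have := single_untried cQ Vk (m := m); rewrite ss um mem_head => /(_ isT).
have sk : next_proposal (state Q k) = Some (m, v) by rewrite /next_proposal ss um.
have [IH1 IH2] := IH k.+1; rewrite addSnnS in IH1.
have := stateS cQ k; rewrite sk => eq_k1.
have := historyS Q k; rewrite sk => eq_h1.
have := singles_propose v Vk ss; rewrite -eq_k1 => ss1.
have rem1 : untried (state Q k.+1) =
    [ffun j => if j == m then l else untried (state Q k) j].
  by rewrite eq_k1; apply/ffunP => i; rewrite !ffunE; case: eqP => // ->; rewrite um.
have hus1 : engaged (state Q k.+1) =
    if prefers (women Q v) (Some m) (engaged (state Q k) v)
    then [ffun j => if j == v then Some m else engaged (state Q k) j]
    else engaged (state Q k).
  by rewrite eq_k1; apply/ffunP => u; rewrite ffunE; case: (prefers _ _ _);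
    rewrite ?ffunE ?andbT ?andbF.
have m_r : all (fun i : 'I_n => m < i) r.
  have := singles_sorted (state Q k); rewrite ss /= path_sortedE; first by case/andP.
  by move=> ? ? ?; apply: ltn_trans.
move: IH1 IH2; rewrite /run_of rem1 hus1 ss1 eq_h1 rev_rcons.
rewrite rankT_cost (rankT_result _ (cQ.2 v) (tE v)) tE -prefers_SomeE.
case: ifP => acc /=; last first.
  by have [-> ic] := insertT_head m_r; move=> -> c2; split=> //; move: c2 ic; lia.
case sv: (engaged (state Q k) v) => [m'|] /=; last by move=> -> c2; split=> //; move: c2; lia.
have m'_r : all (fun i : 'I_n => m' < i) r by have := engaged_free Vk sv; rewrite ss.
by have [-> ic] := insertT_head m'_r; move=> -> c2; split=> //; move: c2 ic; lia.
Qed.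

End TimedGaleShapley.

(** The rank tables cost [n * (4 * n + 3)], the two arrays and the list of men [4 * n], the fuel 1
    and the loop [11 * (n * n) + 1]. *)
Lemma gsT_spec n (Q : strategy n) : complete Q ->
  (gsT Q).1 = (mu Q, rev (history Q (n * n))) /\
  (gsT Q).2 <= 15 * (n * n) + 7 * n + 2.
Proof.
move=> cQ; have [t tE] : exists t, t = (rank_tablesT (women Q)).1 by eexists.
have tQ v m : t v m = index m (women Q v) by rewrite tE rank_tablesT_result //; case: cQ.
have [] := gs_loopT_spec cQ (n * n) 0 tQ; rewrite add0n.
have -> : run_of (state Q 0) (rev (history Q 0)) =
    RunState [ffun m => men Q m] [ffun=> None] (enum 'I_n) [::].
  rewrite /run_of; congr RunState; apply/all_filterP/allP => m _.
  by rewrite /wife; case: pickP => // v; rewrite ffunE.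
have cost1 := rank_tablesT_cost cQ.2.
have cost2 : (build (fun m => op (men Q m))).2 <= n * 2 by apply: build_cost.
have cost3 : (build (fun _ : 'I_n => ret (@None 'I_n))).2 <= n * 1 by apply: build_cost.
rewrite /gsT /bind -tE; cbn [fst snd op ret indices build] => -> cost4.
split=> //; move: cost1 cost2 cost3 cost4; cbn [fst snd op ret indices build].
lia.
Qed.

Lemma proposersT_result n (Q : strategy n) w :
  (proposersT w (rev (history Q (n * n)))).1 = suitors Q w.
Proof.
rewrite /proposersT foldT_result foldl_rev /suitors /suitors_by.
by elim: (history _ _) => //= -[m v] h IHh; rewrite IHh /=; case: ifP.
Qed.

Lemma proposersT_cost n (Q : strategy n) w :
  (proposersT w (rev (history Q (n * n)))).2 <= 2 * (n * n) + 1.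
Proof.
apply: leq_trans (foldT_cost (c := 1) _ _ _) _ => //.
by rewrite size_rev mulnC leq_add2r leq_mul2l size_history orbT.
Qed.

(** * The stability test *)

Lemma wivesT_result n (nu : matching n) m :
  (forall m v, (wife nu m == Some v) = (nu v == Some m)) ->
  (wivesT nu).1 m = wife nu m.
Proof.
move=> nu_wife; rewrite /wivesT /= foldT_result; set g := (X in foldl X).
(* Loop invariant: the table holds the marriages of the women in [s]. No entry is overwritten, since
   a man is the husband of at most one woman. *)
suff H (s : seq 'I_n) (v : 'I_n) :
    (foldl g [ffun=> None] s m == Some v) = (v \in s) && (nu v == Some m).
  case wm: (wife nu m) => [v|].
    by apply/eqP; rewrite H mem_enum -nu_wife wm eqxx.
  case fm: (foldl g _ _ m) => [v|//].
  by move/eqP: fm; rewrite H mem_enum /= -nu_wife wm.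
elim/last_ind: s => [|s u IHs]; first by rewrite ffunE.
rewrite foldl_rcons mem_rcons inE /g /= -/g.
case nu_u: (nu u) => [m'|] /=; last first.
  by rewrite IHs; case: (eqVneq v u) => // ->; rewrite nu_u andbF.
rewrite ffunE; case: (eqVneq m m') => [mm|mm].
  case: (eqVneq v u) => [->|vu]; first by rewrite nu_u mm !eqxx.
  rewrite (inj_eq (@Some_inj _)) eq_sym (negPf vu) /=; apply/esym/negP => /andP[_].
  have /eqP := nu_u; rewrite -mm -!nu_wife => /eqP-> /eqP[uv].
  by rewrite uv eqxx in vu.
rewrite IHs; case: (eqVneq v u) => //= ->; rewrite nu_u (inj_eq (@Some_inj _)).
by rewrite eq_sym (negPf mm) andbF.
Qed.

Definition blocksT n (tm tw : array n (array n nat)) (wf : array n (option 'I_n))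
    (nu : matching n) (m w : 'I_n) : timed bool :=
  let! rm := get tm m in
  let! a := get rm w in
  let! mw := get wf m in
  let! b := rankT rm mw in
  let! c1 := op (a < b) in
  let! rw := get tw w in
  let! a' := get rw m in
  let! mh := get nu w in
  let! b' := rankT rw mh in
  let! c2 := op (a' < b') in
  op (c1 && c2).

Lemma stableTE n (P : strategy n) (nu : matching n) :
  let tm := rank_tablesT (men P) in
  let tw := rank_tablesT (women P) in
  let wf := wivesT nu in
  let b := hasT (fun m => hasT (blocksT tm.1 tw.1 wf.1 nu m) (enum 'I_n)) (enum 'I_n) in
  stableT P nu = (~~ b.1, tm.2 + (tw.2 + (wf.2 + (n + (n + (b.2 + 1)))))).
Proof. by []. Qed.

Lemma blocksT_result n (P : strategy n) (tm tw : array n (array n nat))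
    (wf : array n (option 'I_n)) (nu : matching n) m w :
  complete P -> (forall x, tm m x = index x (men P m)) ->
  (forall x, tw w x = index x (women P w)) -> wf m = wife nu m ->
  (blocksT tm tw wf nu m w).1 =
    prefers (men P m) (Some w) (wife nu m) && prefers (women P w) (Some m) (nu w).
Proof.
move=> cP tmE twE wfE; rewrite /blocksT /=.
rewrite (rankT_result _ (cP.1 m) tmE) (rankT_result _ (cP.2 w) twE).
by rewrite tmE twE wfE.
Qed.

Lemma blocksT_cost n (tm tw : array n (array n nat)) wf nu m w :
  (blocksT tm tw wf nu m w).2 = 11.
Proof. by rewrite /= !rankT_cost. Qed.

Lemma wivesT_cost n (nu : matching n) : (wivesT nu).2 <= 5 * n + 1.
Proof.
rewrite /wivesT /= sum_nat_const card_ord.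
set g := (X in foldT X); set t0 := [ffun _ => _].
have := @foldT_cost _ _ g 2 t0 (enum 'I_n); rewrite size_enum_ord.
have gc t w : (g t w).2 <= 2 by rewrite /g /=; case: (nu w).
by move/(_ gc); move: (foldT _ _ _).2 => c; lia.
Qed.

(** The two families of rank tables cost [8 * (n * n) + 6 * n], the wives [5 * n + 1], the index
    lists [2 * n], the double loop [n * (12 * n + 2) + 1] and the negation 1. *)
Lemma stableT_spec n (P : strategy n) (nu : matching n) : complete P ->
  (forall m v, (wife nu m == Some v) = (nu v == Some m)) ->
  ((stableT P nu).1 <-> stable P nu) /\ (stableT P nu).2 <= 20 * (n * n) + 15 * n + 3.
Proof.
move=> cP nu_wife; rewrite stableTE.
have := rank_tablesT_cost cP.1; have := rank_tablesT_cost cP.2.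
have := wivesT_cost nu.
have := fun i x => rank_tablesT_result i x cP.1.
have := fun i x => rank_tablesT_result i x cP.2.
have := fun m => wivesT_result m nu_wife.
move: (rank_tablesT (men P)) (rank_tablesT (women P)) (wivesT nu) => tm tw wf.
move=> wfE twE tmE wf_c tw_c tm_c; cbv zeta; cbn [fst snd].
have bE m w := blocksT_result cP (tmE m) (twE w) (wfE m).
set b := (X in hasT X _).
have b_c m : (b m).2 <= n * 12 + 1.
  have -> : n * 12 + 1 = size (enum 'I_n) * 12 + 1 by rewrite size_enum_ord.
  by apply: hasT_cost => w; rewrite blocksT_cost.
split; last first.
  have := hasT_cost (enum 'I_n) b_c; rewrite size_enum_ord.
  by move: tm_c tw_c wf_c; move: (hasT _ _).2 tm.2 tw.2 wf.2 => *; lia.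
rewrite hasT_result; split=> [/hasPn no [m [w [pm pw]]]|st].
  have /negP := no m (mem_enum _ _); apply; rewrite hasT_result; apply/hasP.
  by exists w; rewrite ?mem_enum // bE pm pw.
apply/hasPn => m _; rewrite hasT_result; apply/hasPn => w _; rewrite bE.
by apply/negP => /andP[pm pw]; apply: st; exists m, w.
Qed.

(** * Promoted lists, and the values and cost of [Explore] *)

Definition promote n (I l : seq 'I_n) := I ++ [seq m <- l | m \notin I].

Lemma promoteT_result n (I l : seq 'I_n) : (promoteT I l).1 = promote I l.
Proof.
rewrite /promoteT /= catT_result filterT_result; congr cat.
by apply: eq_filter => m /=; rewrite memT_result.
Qed.

Lemma promoteT_cost n (I l : seq 'I_n) : complete_list l -> size I <= n ->
  (promoteT I l).2 <= 2 * (n * n) + 4 * n + 2.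
Proof.
move=> cl In; rewrite /promoteT /= catT_cost; set p := (X in filterT X).
have pc m : (p m).2 <= 2 * n + 2.
  by rewrite /p /=; have := memT_cost m I; move: (memT _ _).2 => c; lia.
have := filterT_cost l pc; rewrite (complete_size cl).
by move: (filterT _ _).2 => c; lia.
Qed.

(** A list built by [Explore] from [Q(w)] is therefore the list of the calling instance with one
    more man moved to the front. *)
Lemma promote_cons n (y : 'I_n) I l : y \notin I ->
  promote (y :: I) l = to_front y (promote I l).
Proof.
move=> yI; rewrite /promote /to_front cat_cons filter_cat -filter_predI; congr (_ :: _ ++ _).
  by symmetry; apply/all_filterP/allP => x; apply: contraTneq => ->.
by apply: eq_filter => x; rewrite /= inE negb_or.
Qed.

Lemma promote_nil n (l : seq 'I_n) : promote [::] l = l.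
Proof. exact: filter_predT. Qed.

Lemma complete_promote n (I l : seq 'I_n) :
  uniq I -> complete_list l -> complete_list (promote I l).
Proof.
move=> + cl; elim: I => [|x I IHI] /=; first by rewrite promote_nil.
by case/andP => xI uI; rewrite promote_cons //; apply/complete_to_front/IHI.
Qed.

Section TimedExploration.

Variables (n : nat) (Q : strategy n) (w : 'I_n).
Hypothesis cQ : complete Q.

Notation suitors_on l := (suitors (replace Q w l) w).

Let n_gt0 : 0 < n.
Proof. exact: leq_ltn_trans (ltn_ord w). Qed.

Let le_n_nn : n <= n * n.
Proof. by rewrite leq_pmulr. Qed.

Let le_1_nn : 0 < n * n.
Proof. by rewrite muln_gt0 n_gt0. Qed.

Let cR l : complete_list l -> complete (replace Q w l).
Proof. exact: complete_replace. Qed.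

Let women_on l : women (replace Q w l) w = l.
Proof. by rewrite /= eqxx. Qed.

Lemma size_uniq_ord (s : seq 'I_n) : uniq s -> size s <= n.
Proof. by move/card_uniqP<-; rewrite -[X in _ <= X]card_ord max_card. Qed.

Definition consistent (NL : explored n) :=
  [/\ NL.1 = unzip1 NL.2, uniq NL.1 & forall y l, (y, l) \in NL.2 -> witness Q w y l].

(* Each new list is charged 47 n^2 steps, for its promotion and the run of GS-M
   on it, so that the costs of the nested calls add up. *)
Definition progress (NL : explored n) (c : timed (explored n)) k :=
  consistent c.1 /\ exists E,
    [/\ c.1.2 = E ++ NL.2,
        forall y l, (y, l) \in E -> {subset suitors_on l <= c.1.1}
      & c.2 <= k + 47 * (n * n) * size E].

Definition explore_new fuel x I (NL : explored n) y : timed (explored n) :=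
  let! known := memT y NL.1 in
  if known then ret NL else
    let! lw := op (women Q w) in
    let! l' := promoteT (y :: x :: I) lw in
    exploreT fuel Q w y (x :: I) l' (y :: NL.1, (y, l') :: NL.2).

Lemma exploreTS fuel x I l NL :
  let g := gsT (replace Q w l) in
  let p := proposersT w g.1.2 in
  let a := afterT x p.1 in
  let c := foldT (explore_new fuel x I) NL a.1 in
  exploreT fuel.+1 Q w x I l NL = (c.1, 1 + (n + 1 + (g.2 + (p.2 + (a.2 + c.2))))).
Proof. by []. Qed.

Lemma explore_new_known fuel x I (NL : explored n) y : y \in NL.1 ->
  explore_new fuel x I NL y = (NL, (memT y NL.1).2 + 0).
Proof. by move=> yN; rewrite /explore_new /bind memT_result yN. Qed.

Lemma explore_new_unknown fuel x I (NL : explored n) y : y \notin NL.1 ->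
  let p := promoteT (y :: x :: I) (women Q w) in
  let c := exploreT fuel Q w y (x :: I) p.1 (y :: NL.1, (y, p.1) :: NL.2) in
  explore_new fuel x I NL y = (c.1, (memT y NL.1).2 + (1 + (p.2 + c.2))).
Proof. by move=> /negPf yN; rewrite /explore_new {1}/bind memT_result yN. Qed.

Lemma foldT_cons A S (f : S -> A -> timed S) s a l :
  foldT f s (a :: l) =
    ((foldT f (f s a).1 l).1, 1 + ((f s a).2 + (foldT f (f s a).1 l).2)).
Proof. by []. Qed.

Lemma progress_subset NL c k : consistent NL -> progress NL c k -> {subset NL.1 <= c.1.1}.
Proof.
move=> [-> _ _] [[-> _ _] [E [-> _ _]]] y yN.
by rewrite /unzip1 map_cat mem_cat yN orbT.
Qed.

(** Only the men who propose after [x] are examined, so the earlier suitors [s1] must be known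
    already. As [N] has no repetition, the bound on [size NL.1 + fuel] prevents the fuel from
    running out. *)
Lemma exploreT_spec fuel x I l NL s1 s2 :
  consistent NL -> n < size NL.1 + fuel ->
  complete_list l -> l = promote (x :: I) (women Q w) -> uniq (x :: I) ->
  {subset x :: I <= NL.1} -> suitors_on l = s1 ++ x :: s2 -> {subset s1 <= NL.1} ->
  progress NL (exploreT fuel Q w x I l NL) (39 * (n * n)) /\
  {subset suitors_on l <= (exploreT fuel Q w x I l NL).1.1}.
Proof.
elim: fuel x I l NL s1 s2 => [|fuel IH] x I l NL s1 s2 cNL.
  by case: cNL => _ /size_uniq_ord + _; rewrite addn0 ltnNge => ->.
rewrite addnS ltnS => fuel_n cl def_l uI sIN eq_s sN.
have xN : x \in NL.1 by apply: sIN; rewrite mem_head.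
have us : uniq (suitors_on l) by apply: suitors_by_uniq; apply: cR.
set f := explore_new fuel x I.
(* Inner induction over the men still to be examined: [s] collects the suitors under [l] that are
   already in [N]. *)
have fold_spec A : forall s (NL : explored n), consistent NL -> n <= size NL.1 + fuel ->
    {subset x :: I <= NL.1} -> suitors_on l = s ++ A -> {subset s <= NL.1} ->
    progress NL (foldT f NL A) (size A * (2 * n + 3) + 1) /\
    {subset A <= (foldT f NL A).1.1}.
  elim: A {cNL fuel_n sIN sN xN} => [|y A IHA] s {}NL cNL fuel_n sIN {}eq_s sN.
    by do 2!split=> //; exists [::]; split.
  have sN' (NL' : seq 'I_n) : {subset NL.1 <= NL'} -> y \in NL' -> {subset rcons s y <= NL'}.
    by move=> sub yN z; rewrite mem_rcons inE => /orP[/eqP->|/sN/sub].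
  have [eqN uN wit] := cNL; have size_N := size_uniq_ord uN.
  have mem_c : (memT y NL.1).2 <= 2 * n + 1.
    by have := memT_cost y NL.1; move: (memT _ _).2 => c; lia.
  rewrite -cat_rcons in eq_s.
  rewrite foldT_cons; have [yN|yN] := boolP (y \in NL.1).
    rewrite /f explore_new_known // -/f; cbn [fst snd].
    have [prog sA] := IHA _ NL cNL fuel_n sIN eq_s (sN' NL.1 (fun _ => id) yN).
    have [cNL' [E [eqE clE costE]]] := prog; split; last first.
      move=> z; rewrite inE => /orP[/eqP->|/sA//].
      exact: (progress_subset cNL prog).
    split=> //; exists E; split=> //; move: costE mem_c.
    by cbn [fst snd size]; move: (foldT _ _ _).2 (memT _ _).2 => ? ?; lia.
  have yI : y \notin x :: I by apply: contra yN => /sIN.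
  rewrite /f explore_new_unknown // -/f.
  set p := promoteT _ _.
  have pE : p.1 = promote (y :: x :: I) (women Q w) by apply: promoteT_result.
  have p_c : p.2 <= 2 * (n * n) + 4 * n + 2.
    apply: promoteT_cost; first by case: cQ.
    by apply: size_uniq_ord; rewrite /= yI.
  clearbody p; have def_p : p.1 = to_front y l by rewrite pE promote_cons // def_l.
  have cl1 : complete_list p.1 by rewrite def_p; apply: complete_to_front.
  have ys : y \notin s.
    by move: us; rewrite eq_s cat_uniq rcons_uniq => /and3P[/andP[]].
  (* Moving [y] to the front affects no comparison made before he proposes, so he still proposes,
     right after [s]. Thus [p.1] is a witness for [y], and the earlier suitors in the nested call
     are known. *)
  have [s2' eq_s'] : exists s2', suitors_on p.1 = s ++ y :: s2'.
    rewrite cat_rcons in eq_s.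
    apply: (suitors_same_order (cR cl) (cR cl1) (same_but_replace _ _ _ _) eq_s).
    by rewrite !women_on def_p; apply: to_front_order.
  pose NL1 : explored n := (y :: NL.1, (y, p.1) :: NL.2).
  have cNL1 : consistent NL1.
    split=> [||y' l']; rewrite /= -?eqN ?yN ?uN //.
    rewrite inE => /orP[/eqP[-> ->]|/wit//].
    split=> //; first by rewrite def_p /= eqxx.
    by rewrite eq_s' mem_cat mem_head orbT.
  have sub1 : {subset NL.1 <= NL1.1} by move=> z zN; rewrite inE zN orbT.
  have [] := IH y (x :: I) p.1 NL1 s s2' cNL1 _ cl1 pE _ _ eq_s' _.
  - by rewrite addSn ltnS.
  - by rewrite /= yI.
  - by move=> z; rewrite inE => /orP[/eqP->|/sIN/sub1//]; rewrite mem_head.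
  - by move=> z /sN /sub1.
  set c := exploreT _ _ _ _ _ _ _ => prog_c sub_c.
  have sub2 := progress_subset cNL1 prog_c.
  have sub3 : {subset NL.1 <= c.1.1} by move=> z /sub1/sub2.
  have yc : y \in c.1.1 by apply: sub2; rewrite mem_head.
  have [cc [E1 [eqE1 clE1 costE1]]] := prog_c.
  have [|prog_A sA] := IHA _ c.1 cc _ (fun z zI => sub3 z (sIN z zI)) eq_s (sN' _ sub3 yc).
    (* [N] only grows, so the same fuel suffices for the remaining men. *)
    by apply: leq_trans fuel_n _; rewrite leq_add2r; apply: uniq_leq_size.
  have sub4 := progress_subset cc prog_A; have [cA [E2 [eqE2 clE2 costE2]]] := prog_A.
  cbn [fst snd]; rewrite -/NL1 -/c; split; last first.
    by move=> z; rewrite inE => /orP[/eqP->|/sA//]; apply: sub4.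
  split=> //; exists (E2 ++ E1 ++ [:: (y, p.1)]); split.
  - by cbn [fst snd]; rewrite eqE2 eqE1 -!catA.
  - cbn [fst snd] => y' l'; rewrite !mem_cat inE => /or3P[/clE2//|/clE1 sc|/eqP[_ ->]] z.
      by move/sc/sub4.
    by move/sub_c/sub4.
  (* A new man pays [2 * n + 3] for the loop, the membership test and the access to the list. His
     list is charged at most [8 * (n * n)] for its promotion and [39 * (n * n)] for its call, which
     makes 47. *)
  move: costE1 costE2 p_c mem_c; rewrite !size_cat /=; cbn [fst snd].
  move: c.2 p.2 (memT _ _).2 (foldT _ _ _).2 (size E1) (size E2) (size A).
  by move: n_gt0 le_n_nn le_1_nn; clear; move=> *; lia.
have [g_res g_c] := gsT_spec (cR cl).
rewrite exploreTS -/f g_res; cbn [fst snd]; rewrite proposersT_result eq_s.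
have xs1 : x \notin s1.
  by move: us; rewrite eq_s cat_uniq /= negb_or => /and3P[_ /andP[]].
rewrite afterT_result //.
have [||prog sA] := fold_spec s2 (rcons s1 x) NL cNL fuel_n sIN.
- by rewrite cat_rcons.
- by move=> z; rewrite mem_rcons inE => /orP[/eqP->|/sN].
have sub := progress_subset cNL prog; have [cc [E [eqE clE costE]]] := prog.
split; last first.
  by move=> z; rewrite mem_cat inE => /or3P[/sN/sub//|/eqP->|/sA//]; apply: sub.
split=> //; exists E; split=> //; cbn [fst snd].
have := proposersT_cost (replace Q w l) w; have := afterT_cost x (s1 ++ x :: s2).
have := size_uniq_ord us; rewrite eq_s size_cat; cbn [size].
move: costE g_c.
move: (afterT _ _).2 (proposersT _ _).2 (gsT (replace Q w l)).2 (foldT _ _ _).2.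
move=> ca cp cg cf costE g_c sz c1 c2.
(* The call itself costs at most [19 * (n * n) + 13 * n + 7], and 19 + 13 + 7 is the constant 39. *)
have : size s2 * (2 * n) <= 2 * (n * n).
  by rewrite mulnCA leq_pmul2l // leq_pmul2r //; move: sz; lia.
move: costE g_c sz c1 c2 n_gt0 le_n_nn le_1_nn.
move: (size s1) (size s2) (size E) => z1 z2 z; rewrite mulnDr; lia.
Qed.

End TimedExploration.

(** * The subroutine, the test for one woman, and the whole algorithm *)

Section Algorithm.

Variables (n : nat) (P Q : strategy n).
Hypotheses (cP : complete P) (cQ : complete Q).

Lemma subroutineT_spec w :
  let c := subroutineT Q w in
  [/\ consistent Q w c.1,
      forall l, complete_list l -> {subset suitors (replace Q w l) w <= c.1.1}
    & c.2 <= 75 * (n * (n * n))].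
Proof.
have n_gt0 : 0 < n by exact: leq_ltn_trans (ltn_ord w).
have le_n_nn : n <= n * n by rewrite leq_pmulr.
have le_nn_nnn : n * n <= n * (n * n) by rewrite leq_pmull.
have [g_res g_c] := gsT_spec cQ; have p_c := proposersT_cost Q w.
have subE : subroutineT Q w =
    let p := proposersT w (rev (history Q (n * n))) in
    let d := if p.1 is x :: _ then
        let! lw := op (women Q w) in
        let! l := promoteT [:: x] lw in
        exploreT n Q w x [::] l ([:: x], [:: (x, l)])
      else ret ([::], [::]) in
    (d.1, (gsT Q).2 + (p.2 + d.2)).
  by rewrite /subroutineT {1}/bind g_res.
cbv zeta; rewrite {}subE; cbv zeta; rewrite proposersT_result.
case eq_s: (suitors Q w) => [|x s].
  cbn [fst snd ret]; split; first by split.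
    by apply: (suitors_explored cQ) => [y s|y]; rewrite ?eq_s.
  by move: g_c p_c le_n_nn le_nn_nnn n_gt0; move: (gsT Q).2 (proposersT _ _).2 => ? ?; lia.
pose l := (promoteT [:: x] (women Q w)).1.
have lE : l = promote [:: x] (women Q w) by apply: promoteT_result.
have l_c : (promoteT [:: x] (women Q w)).2 <= 2 * (n * n) + 4 * n + 2.
  by apply: promoteT_cost; first by case: cQ.
have cl : complete_list l by rewrite lE; apply: complete_promote; last by case: cQ.
have [s' eq_s'] : exists s', suitors (replace Q w l) w = [::] ++ x :: s'.
  by apply: (suitors_same_order (s1 := [::]) cQ (complete_replace w cQ cl) _ eq_s);
    first exact: same_but_replacer.
have wit : witness Q w x l.
  by split=> //; [rewrite lE /= eqxx | rewrite eq_s' mem_head].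
pose NL0 : explored n := ([:: x], [:: (x, l)]).
have cNL0 : consistent Q w NL0.
  by split=> // y l'; rewrite inE => /eqP[-> ->].
have [] := exploreT_spec (fuel := n) cQ cNL0 (leqnn _) cl lE _ _ eq_s' _; try by [].
cbn [bind op fst snd]; rewrite -/l -/NL0; set c := exploreT _ _ _ _ _ _ _ => prog sub.
have xN : x \in c.1.1 by apply: (progress_subset cNL0 prog); rewrite mem_head.
have [cc [E [eqE clE costE]]] := prog; split; cbn [fst snd] => //.
  (* Closure: the suitors under the first list are covered by [sub], those under the later lists by
     [clE]. *)
  apply: (suitors_explored cQ) => [y s''|y]; first by rewrite eq_s => -[<-].
  have [eqN _ wE] := cc; rewrite eqN => /mapP[[y' l'] yl' ->]; rewrite -eqN.
  exists l'; first exact: wE.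
  by move: yl'; rewrite eqE mem_cat inE => /orP[/clE|/eqP[_ ->]].
(* The list of [x] is not in [E], so [E] has at most [n - 1] entries, charged [47 * (n * n)] each.
   All other costs are at most [75 * (n * n)], and 47 + (75 - 47) gives 75. *)
have [eqN uN _] := cc; have := size_uniq_ord uN.
rewrite eqN size_map eqE size_cat addn1 => /(leq_mul (leqnn (47 * (n * n)))).
move: costE l_c g_c p_c le_n_nn le_nn_nnn n_gt0.
by move: (gsT Q).2 (proposersT _ _).2 c.2 (promoteT _ _).2 (size E) => *; lia.
Qed.

Definition checkT (nu : matching n) w : timed bool :=
  let! NL := subroutineT Q w in
  let! lw := op (women P w) in
  let! t := rank_tableT lw in
  let! h := get nu w in
  let! b := rankT t h in
  let! N' := filterT (fun m => let! a := get t m in op (a < b)) NL.1 in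
  hasT (fun m =>
    let! o := lookupT m NL.2 in
    if o is Some l then
      let! Q' := replaceT Q w l in
      let! g' := gsT Q' in
      stableT P g'.1
    else ret false) N'.

Lemma algorithmTE : algorithmT P Q =
  let! g := gsT Q in
  let! all_women := indices n in
  let! found := hasT (checkT g.1) all_women in
  ret (if found then No else Yes).
Proof. by []. Qed.

(** Each candidate costs at most [35 * (n * n) + 25 * n + 7]. With the subroutine and the remaining
    work the total is at most [110 * n ^ 3 + 25 * n ^ 2 + 15 * n + 6], whence 156. *)
Lemma checkT_spec w : let c := checkT (mu Q) w in
  (c.1 <-> exists l, stable_manipulation P Q w l) /\ c.2 <= 156 * (n * (n * n)).
Proof.
have n_gt0 : 0 < n by exact: leq_ltn_trans (ltn_ord w).
have le_n_nn : n <= n * n by rewrite leq_pmulr.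
have le_nn_nnn : n * n <= n * (n * n) by rewrite leq_pmull.
rewrite /checkT; have := subroutineT_spec w.
set s := subroutineT Q w => -[[eqN uN wit] sub s_c].
have tE x : (rank_tableT (women P w)).1 x = index x (women P w).
  by apply: rank_tableT_result; case: cP.
have t_c : (rank_tableT (women P w)).2 <= 4 * n + 1.
  by apply/rank_tableT_cost/complete_size; case: cP.
move: tE t_c; set t := rank_tableT (women P w) => tE t_c.
have size_N := size_uniq_ord uN.
rewrite /bind; cbn [fst snd op get]; rewrite -/t.
rewrite (rankT_result _ (cP.2 w) tE) rankT_cost.
set p := (X in filterT X); set q := (X in hasT X _).
have pE m : (p m).1 = (index m (women P w) < position (women P w) (mu Q w)).
  by rewrite /p /= tE.
have p_c m : (p m).2 <= 2 by [].
have qE m l : (lookupT m s.1.2).1 = Some l -> witness Q w m l ->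
    ((q m).1 <-> stable P (mu (replace Q w l))) /\
    (q m).2 <= (lookupT m s.1.2).2 + (n + 1 + (35 * (n * n) + 22 * n + 5)).
  move=> lm [cl _ _]; have cR := complete_replace w cQ cl.
  have [g_res g_c] := gsT_spec cR.
  have [st_res st_c] := stableT_spec cP (mu_wifeP cR).
  rewrite /q lm; cbn [fst snd replaceT]; rewrite g_res; cbn [fst snd]; split=> //.
  move: g_c st_c; move: (lookupT _ _).2 (gsT (replace Q w l)).2 (stableT _ _).2 => ? ? ?; lia.
have q_c m : (q m).2 <= 35 * (n * n) + 25 * n + 7.
  have := lookupT_cost m s.1.2; have := size_map fst s.1.2; rewrite -/(unzip1 _) -eqN => <-.
  move: (lookupT_result m s.1.2); case lm: (lookupT _ _).1 => [l|].
    move/wit/(qE _ _ lm) => [_]; move: size_N; move: (q m).2 (lookupT _ _).2 => ? ?; lia.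
  rewrite /q lm; cbn [fst snd ret]; move: size_N; move: (lookupT _ _).2 => ?; lia.
split; last first.
  have := hasT_cost (filterT p s.1.1).1 q_c; rewrite filterT_result.
  have := filterT_cost s.1.1 p_c.
  have : size [seq a <- s.1.1 | (p a).1] <= n.
    by rewrite size_filter (leq_trans (count_size _ _)).
  move/(leq_mul (leqnn (35 * (n * n) + 25 * n + 8))).
  move: size_N t_c s_c le_n_nn le_nn_nnn n_gt0.
  move: (filterT _ _).2 (hasT _ _).2 t.2 s.2 (size (filter _ _)) => *; lia.
rewrite hasT_result filterT_result; split=> [/hasP[m]|[l [cl pref st]]].
  rewrite mem_filter pE => /andP[pm mN]; move: (lookupT_result m s.1.2).
  case lm: (lookupT _ _).1 => [l|]; last by rewrite -eqN mN.
  move/wit => wl; have [qm _] := qE _ _ lm wl; move/qm => st; exists l.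
  have [cl _ _] := wl; split=> //.
  by rewrite (witness_mu cQ wl) prefers_SomeE.
(* Given a manipulation [l], the husband [m] it wins has been explored, and his recorded list [l']
   yields the same stable matching. *)
have [m mu_m] := mu_husband (complete_replace w cQ cl) w.
have mN : m \in s.1.1 := sub l cl m (mem_suitors (complete_replace w cQ cl) mu_m).
apply/hasP; exists m; first by rewrite mem_filter pE mN andbT -prefers_SomeE -mu_m.
move: (lookupT_result m s.1.2); case lm: (lookupT _ _).1 => [l'|]; last by rewrite -eqN mN.
move/wit => wl; have [qm _] := qE _ _ lm wl.
by apply/qm; rewrite -(mu_witness cQ cl mu_m wl).
Qed.

End Algorithm.

Theorem theorem2 :
  (forall (n : nat) (P Q : strategy n), complete P -> complete Q ->
     result (algorithmT P Q) = Yes <-> stable_nash P Q) /\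
  (exists C : nat, forall (n : nat) (P Q : strategy n),
     0 < n -> complete P -> complete Q -> cost (algorithmT P Q) <= C * n ^ 4).
Proof.
split=> [n P Q cP cQ|].
  rewrite algorithmTE /result; cbn [bind fst snd indices ret].
  rewrite hasT_result (gsT_spec cQ).1; cbn [fst snd].
  case: ifP => [/hasP[w _ /(checkT_spec cP cQ w).1 [l man]]|/negbT/hasPn no_w].
    by split=> // -[]; exists w, l.
  split=> // _ [w [l man]]; have /negP[] := no_w w (mem_enum _ _).
  by apply/(checkT_spec cP cQ w).1; exists l.
(* The sum is at most [156 * n ^ 4 + 15 * n ^ 2 + 9 * n + 3], so 183 would do; 200 is a round
   bound. *)
exists 200 => n P Q n_gt0 cP cQ.
rewrite algorithmTE /cost; cbn [bind fst snd indices ret].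
have [g_res g_c] := gsT_spec cQ; rewrite g_res; cbn [fst snd].
have := hasT_cost (enum 'I_n) (fun w => (checkT_spec cP cQ w).2).
rewrite size_enum_ord; have le_n_nn : n <= n * n by rewrite leq_pmulr.
have le_nn_nnn : n * n <= n * (n * n) by rewrite leq_pmull.
have le_nnn_nnnn : n * (n * n) <= n * (n * (n * n)) by rewrite leq_pmull.
have -> : n ^ 4 = n * (n * (n * n)) by [].
by move: g_c; move: (gsT Q).2 (hasT _ _).2 => *; lia.
Qed.
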